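(* Suppose Assumptions AD and JK (stated in the context) hold, and assume $\mathcal V\cap\operatorname{null}(C)=\emptyset$, where $\mathcal V=\{v\in\mathbb R^m: v^\top A=0_R^\top,\ v^\top\iota_m=1\}$. Let $v^\ast$ be a minimiser of $v^\top Cv$ over $\mathcal V$. Let $q\ge1$ and let $u_1^\ast,\dots,u_q^\ast\in\mathbb R^m$ be such that, with $U^\ast=(u_1^\ast,\dots,u_q^\ast)$ (an $m\times q$ matrix), $$U^{\ast\top}A=0_{q\times R},\qquad U^{\ast\top}\iota_m=0_q,\qquad U^{\ast\top}CU^\ast=(v^{\ast\top}Cv^\ast)\,I_q.$$ Define $\tilde\varphi=v^{\ast\top}\hat{\boldsymbol\varphi}$, $\tilde\sigma_q^2=\frac1q\sum_{l=1}^q(u_l^{\ast\top}\hat{\boldsymbol\varphi})^2$ and $\tilde\sigma_q=\sqrt{\tilde\sigma_q^2}$. Then $$\mathcal J_q:=\frac{\tilde\varphi-\varphi}{\tilde\sigma_q}\xrightarrow{d}t_q$$ as $N,T\to\infty$ with $N/T\to\gamma^2\in(0,\infty)$, where $t_q$ is the Student $t$-distribution with $q$ degrees of freedom.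
   Context: Setting: panel data indexed by $i=1,\dots,N$, $t=1,\dots,T$; $\varphi$ is a scalar parameter of interest; $r_{NT}>0$ is a normalising sequence; all limits are as $N,T\to\infty$ with $N/T\to\gamma^2\in(0,\infty)$. $\iota_m$ is the $m$-vector of ones; $I_q$ the $q\times q$ identity. Assumption AD: there is an estimator $\hat\varphi^{(0)}$ of $\varphi$ with $r_{NT}(\hat\varphi^{(0)}-\varphi)=z_{NT}+\sum_{r=1}^R\mu_{r,NT}+o_p(1)$, where $\mu_{1,NT},\dots,\mu_{R,NT}$ are nonstochastic (possibly depending on $N,T$, not necessarily bounded) and $z_{NT}\xrightarrow{d}\mathcal N(0,\sigma^2)$ with $\sigma^2\in(0,\infty)$. Assumption JK: for a fixed integer $m\ge R+2$ there are estimators $\hat\varphi^{(1)},\dots,\hat\varphi^{(m-1)}$ (computed on subsamples) such that, with $\hat{\boldsymbol\varphi}=(\hat\varphi^{(0)},\dots,\hat\varphi^{(m-1)})^\top$ and $\boldsymbol\mu_{NT}=(\mu_{1,NT},\dots,\mu_{R,NT})^\top$, $$r_{NT}(\hat{\boldsymbol\varphi}-\varphi\iota_m)=\boldsymbol z_{NT}+A\boldsymbol\mu_{NT}+o_p(1),\qquad \boldsymbol z_{NT}\xrightarrow{d}\mathcal N(0_m,\sigma^2C),$$ where $A$ ($m\times R$) and $C$ ($m\times m$) are known nonrandom matrices with $\operatorname{rank}(A)=R$, $\iota_m\notin\operatorname{col}(A)$, $\operatorname{null}((A,\iota_m)^\top)\not\subseteq\operatorname{null}(C)$, and $C$ symmetric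 positive semidefinite. *)

(* Defs.v *)
From HB Require Import structures.
From mathcomp Require Import all_boot all_order all_algebra.
From mathcomp Require Import all_classical all_reals all_analysis.
From mathcomp Require Import normal_distribution.

Set Implicit Arguments.
Unset Strict Implicit.
Unset Printing Implicit Defensive.
Import Order.TTheory GRing.Theory Num.Theory.
Import numFieldNormedType.Exports.
Local Open Scope classical_set_scope.
Local Open Scope ring_scope.

(* The asymptotic regime "N, T -> oo with N/T -> g2": the filter on pairs
   (N, T) generated by the sets
   { (N,T) | j <= N, j <= T, |N/T - g2| < 1/(j+1) },  j : nat. *)
Definition panel_filter (R : realType) (g2 : R) : set_system (nat * nat) :=
  filter_from [set: nat]
    (fun j : nat => [set NT : nat * nat | (j <= NT.1)%N /\ (j <= NT.2)%N /\
        `| (NT.1)%:R / (NT.2)%:R - g2 | < (j.+1)%:R^-1]).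

Definition rv_mx (R : realType) d (T : measurableType d) (m n : nat)
  (X : T -> 'M[R]_(m, n)) : Prop :=
  forall i j, measurable_fun [set: T] (fun w => X w i j).

Definition bcont (R : realType) (U : topologicalType) (f : U -> R) : Prop :=
  continuous f /\ exists M : R, forall x, `|f x| <= M.

Definition cvg_prob0 (R : realType) d (T : measurableType d)
  (P : probability T R) (I : Type) (F : set_system I) (X : I -> T -> R) : Prop :=
  forall eps : R, 0 < eps ->
    (fun i => P [set w | eps < `|X i w| ]) @ F --> 0%E.

Definition op1_mx (R : realType) d (T : measurableType d)
  (P : probability T R) (I : Type) (F : set_system I) (m n : nat)
  (X : I -> T -> 'M[R]_(m, n)) : Prop :=
  forall i j, cvg_prob0 P F (fun k w => X k w i j).

Definition cvg_dist_pdf (R : realType) d (T : measurableType d)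
  (P : probability T R) (I : Type) (F : set_system I) (X : I -> T -> R)
  (p : R -> R) : Prop :=
  forall f : R -> R, bcont f ->
    (fun i => \int[P]_w (f (X i w))%:E)%E @ F -->
      (\int[lebesgue_measure]_x (f x * p x)%:E)%E.

Definition cvg_dist_vec (R : realType) d (T : measurableType d)
  (P : probability T R) d' (T' : measurableType d') (Q : probability T' R)
  (I : Type) (F : set_system I) (m : nat)
  (X : I -> T -> 'cV[R]_m) (Z : T' -> 'cV[R]_m) : Prop :=
  forall f : 'cV[R]_m -> R, bcont f ->
    (fun i => \int[P]_w (f (X i w))%:E)%E @ F --> (\int[Q]_w (f (Z w))%:E)%E.

Definition normal0_rv (R : realType) d (T : measurableType d)
  (Q : probability T R) (X : T -> R) (v : R) : Prop :=
  measurable_fun [set: T] X /\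
  forall B : set R, measurable B ->
    Q (X @^-1` B) = (if 0 < v then normal_prob 0 (Num.sqrt v) B
                     else \d_(0 : R) B).

(* Z ~ N(0, S) (possibly singular): every linear combination a^T Z is
   N(0, a^T S a) *)
Definition gaussian0_vec (R : realType) d (T : measurableType d)
  (Q : probability T R) (m : nat) (Z : T -> 'cV[R]_m) (S : 'M[R]_m) : Prop :=
  rv_mx Z /\
  forall a : 'cV[R]_m,
    normal0_rv Q (fun w => (a^T *m Z w) ord0 ord0) ((a^T *m S *m a) ord0 ord0).

(* Student t density with q degrees of freedom, written as the normalised
   kernel (1 + x^2/q)^(-(q+1)/2) *)
Definition t_kernel (R : realType) (q : nat) (x : R) : R :=
  powR (1 + x ^+ 2 / q%:R) (- ((q%:R + 1) / 2)).

Definition t_pdf (R : realType) (q : nat) (x : R) : R :=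
  t_kernel q x / fine (\int[lebesgue_measure]_y (t_kernel q y)%:E)%E.

(* Main.v *)
Require Import Defs.
From HB Require Import structures.
From mathcomp Require Import all_boot all_order all_algebra.
From mathcomp Require Import all_classical all_reals all_analysis.
From mathcomp Require Import measurable_realfun normal_distribution.
From mathcomp Require Import ring lra.
Set Implicit Arguments.
Unset Strict Implicit.
Unset Printing Implicit Defensive.
Import Order.TTheory GRing.Theory Num.Theory.
Import numFieldNormedType.Exports.
Local Open Scope classical_set_scope.
Local Open Scope ring_scope.

(** Along the panel filter the statistic is [tstat (z + e)] with [e = o_p(1)]:
    [tstat x = v^T x / sqrt (q^-1 * |U^T x|^2)] is positively homogeneous of
    degree 0 and ignores the bias [A mu] because [v] and [U] are orthogonal to
    the columns of [A]. It is continuous off [{U^T x = 0}], a null set for the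
    Gaussian limit [Z], so Slutsky's lemma and continuous mapping reduce the
    theorem to the law of [tstat Z].

    Minimality of [v] gives [U^T C v = 0], so up to a common scale
    [(v^T Z, U^T Z) = (X, W)] has all linear combinations [a0 X + c^T W]
    distributed as [N(0, a0^2 + |c|^2)]. Independence of [X] and [S = |W|^2] is
    extracted from this as follows: since [exp (- t^2 / 2)] is the
    characteristic function of the standard normal law, the expectations of
    [exp (- b S) * exp (- a (X - y)^2)] are mixtures of expectations of cosines
    of linear combinations and hence factorise; Bernstein polynomials in
    [exp (- S)] replace [exp (- b S)] by an arbitrary function of [S], and
    letting the Gaussian kernel in [X] concentrate replaces it by an arbitrary
    continuous function of [X]. Conditionally on [S], the ratio is then normal
    with variance [q / S]. Its density is a mixture which the Laplace transform
    [E exp (- b S) = (1 + 2 b)^(- q / 2)] identifies, up to a constant, with the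
    Student kernel. *)

(** * Bounded measurable functions and probability measures *)

(** [gaussian0_vec] provides only the one-dimensional laws of linear combinations, and [C] may be
    singular. Everything about the pair [(X, S)] is therefore drawn from expectations of cosines; a
    free phase lets real cosines do the work of complex exponentials. The density of the ratio given
    [S] carries the factor [S^(1/2)], and [E S^(1/2) exp (- b S)] is not a derivative of the Laplace
    transform. Multiplying by a second Gaussian density in an auxiliary variable, of integral 1,
    raises the factor to [S], which one differentiation of [(1 + 2 b)^(- q / 2)] produces. Neither
    the chi-square density nor the Gamma function occurs: testing the law against the constant 1
    yields the constant of the Student density. The statistic is discontinuous on [{U^T x = 0}] and
    lives on a noncompact space. Cutoffs remove a neighbourhood of that set and of infinity, making
    the truncated test functions uniformly continuous; the lost mass is small for the limit [Z], and
    convergence of the cutoffs' own expectations carries this over to the sample. *)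

Section bounded_measurable.
Context d (T : measurableType d) (R : realType).
Implicit Types (f g : T -> R) (M : R).

Definition bmfun f := measurable_fun [set: T] f /\ exists M, forall x, `|f x| <= M.

Lemma bmfun_cst (a : R) : bmfun (fun=> a).
Proof. by split; [exact: measurable_cst|exists `|a|]. Qed.

Lemma bmfunD f g : bmfun f -> bmfun g -> bmfun (fun x => f x + g x).
Proof.
move=> [mf [M fM]] [mg [N gN]]; split; first exact: measurable_funD.
by exists (M + N) => x; rewrite (le_trans (ler_normD _ _))// lerD.
Qed.

Lemma bmfunM f g : bmfun f -> bmfun g -> bmfun (fun x => f x * g x).
Proof.
move=> [mf [M fM]] [mg [N gN]]; split; first exact: measurable_funM.
by exists (M * N) => x; rewrite normrM ler_pM.
Qed.

Lemma bmfunN f : bmfun f -> bmfun (fun x => - f x).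
Proof.
move=> bf; have := bmfunM (bmfun_cst (-1)) bf.
by under eq_fun do rewrite mulN1r.
Qed.

Lemma bmfunB f g : bmfun f -> bmfun g -> bmfun (fun x => f x - g x).
Proof. by move=> bf bg; apply: bmfunD => //; exact: bmfunN. Qed.

Lemma bmfun_le1 f : measurable_fun [set: T] f -> (forall x, 0 <= f x <= 1) -> bmfun f.
Proof.
by move=> mf f01; split => //; exists 1 => x; have /andP[f0 f1] := f01 x; rewrite ger0_norm.
Qed.

Lemma bmfun_integrable (mu : {finite_measure set T -> \bar R}) f :
  bmfun f -> mu.-integrable [set: T] (EFin \o f).
Proof.
move=> [mf [M fM]]; apply: measurable_bounded_integrable => //.
  by rewrite ltey_eq fin_num_measure.
exists M; split; first exact: num_real.
by move=> y My x _ /=; rewrite (le_trans (fM x))// ltW.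
Qed.

Lemma integral_Rintegral (mu : {finite_measure set T -> \bar R}) f :
  bmfun f -> (\int[mu]_x (f x)%:E)%E = (\int[mu]_x f x)%:E.
Proof.
move=> bf; rewrite /Rintegral fineK//.
exact: integrable_fin_num (bmfun_integrable mu bf).
Qed.

End bounded_measurable.

Section probability_Rintegral.
Context d (T : measurableType d) (R : realType) (P : probability T R).
Implicit Types (f g : T -> R) (M : R).

Lemma Rintegral_cst1 (a : R) : \int[P]_x a = a.
Proof. by rewrite Rintegral_cst//= probability_setT mulr1. Qed.

Lemma bmRintegralD f g : bmfun f -> bmfun g ->
  \int[P]_x (f x + g x) = \int[P]_x f x + \int[P]_x g x.
Proof. by move=> bf bg; rewrite RintegralD//; exact: bmfun_integrable. Qed.

Lemma bmRintegralB f g : bmfun f -> bmfun g ->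
  \int[P]_x (f x - g x) = \int[P]_x f x - \int[P]_x g x.
Proof. by move=> bf bg; rewrite RintegralB//; exact: bmfun_integrable. Qed.

Lemma bmRintegralZl f a : bmfun f -> \int[P]_x (a * f x) = a * \int[P]_x f x.
Proof. by move=> bf; rewrite RintegralZl//; exact: bmfun_integrable. Qed.

Lemma bmRintegralZr f a : bmfun f -> \int[P]_x (f x * a) = \int[P]_x f x * a.
Proof. by move=> bf; rewrite RintegralZr//; exact: bmfun_integrable. Qed.

Lemma bmRintegral_le f g : bmfun f -> bmfun g -> (forall x, f x <= g x) ->
  \int[P]_x f x <= \int[P]_x g x.
Proof. by move=> bf bg fg; apply: le_Rintegral => //; exact: bmfun_integrable. Qed.

Lemma bmRintegral_norm f g : bmfun f -> bmfun g -> (forall x, `|f x| <= g x) ->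
  `|\int[P]_x f x| <= \int[P]_x g x.
Proof.
move=> bf bg fg; rewrite (le_trans (le_normr_Rintegral _ _))//.
  exact: bmfun_integrable.
apply: bmRintegral_le => //; have [mf [M fM]] := bf; split.
  exact: measurableT_comp.
by exists M => x; rewrite normr_id.
Qed.

Lemma bounded_convergence (f_ : nat -> T -> R) f M :
  (forall n, measurable_fun [set: T] (f_ n)) -> measurable_fun [set: T] f ->
  {ae P, forall x, f_ ^~ x @ \oo --> f x} ->
  (forall n x, `|f_ n x| <= M) ->
  \int[P]_x f_ n x @[n --> \oo] --> \int[P]_x f x.
Proof.
move=> mf_ mf ff fM.
have bcst := @bmfun_cst _ T _ M.
have [|||||/= inf _] := @dominated_convergence _ _ _ P setT measurableT
  (fun n => EFin \o f_ n) (EFin \o f) (EFin \o cst M).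
- by move=> n; exact/measurable_EFinP.
- exact/measurable_EFinP.
- by apply: filterS ff => x fx _; apply: cvg_EFin => //; exact: nearW.
- exact: bmfun_integrable.
- by apply: aeW => x n _ /=; rewrite lee_fin fM.
rewrite (_ : (\int[P]_x (f x)%:E)%E = (\int[P]_x f x)%:E); last first.
  by rewrite /Rintegral fineK//; exact: integrable_fin_num inf.
by move/fine_cvgP => [].
Qed.

End probability_Rintegral.

Lemma bmRintegral_Fubini (R : realType) d1 (T1 : measurableType d1) d2
    (T2 : measurableType d2) (P1 : probability T1 R) (P2 : probability T2 R)
    (f : T1 -> T2 -> R) :
  bmfun (fun z : T1 * T2 => f z.1 z.2) ->
  \int[P1]_x \int[P2]_y f x y = \int[P2]_y \int[P1]_x f x y.
Proof.
move=> [mf [M fM]].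
have mx x : bmfun (f x).
  split; last by exists M => y; exact: (fM (x, y)).
  exact: (measurableT_comp mf (pair1_measurable x)).
have my y : bmfun (f ^~ y).
  split; last by exists M => x; exact: (fM (x, y)).
  exact: (measurableT_comp mf (pair2_measurable y)).
have := @Fubini _ _ _ _ R P1 P2 (fun z => (f z.1 z.2)%:E).
move=> /(_ _)/= F.
rewrite /Rintegral; congr fine.
under eq_integral do rewrite -/(Rintegral _ _ _) -integral_Rintegral//.
under [RHS]eq_integral do rewrite -/(Rintegral _ _ _) -integral_Rintegral//.
apply: F; apply: measurable_bounded_integrable => //.
  rewrite [X in (X < _)%E](_ : _ = 1%E) ?ltry//.
  have := @product_measure1E _ _ _ _ R P1 P2 setT setT measurableT measurableT.
  by rewrite setXTT/= !probability_setT mule1.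
exists M; split; first exact: num_real.
by move=> y My x _ /=; rewrite (le_trans (fM x))// ltW.
Qed.

Section normal_integral.
Context {R : realType}.
Local Notation mu := (@lebesgue_measure R).

(** The Radon-Nikodym derivative of [normal_prob] agrees almost everywhere with [normal_pdf],
    because both have the same integral over every measurable set. *)
Lemma integral_normal_prob (m s : R) (f : R -> R) : bmfun f ->
  (\int[normal_prob m s]_x (f x)%:E = \int[mu]_x (f x * normal_pdf m s x)%:E)%E.
Proof.
move=> bf.
have [mf _] := bf; have inf := bmfun_integrable (normal_prob m s) bf.
rewrite -(Radon_Nikodym_change_of_variables (normal_prob_dominates m s))//=.
apply: ae_eq_integral => //.
- apply: emeasurable_funM; first exact/measurable_EFinP.
  apply: (measurable_int mu).
  by apply: Radon_Nikodym_integrable; exact: normal_prob_dominates.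
- apply/measurable_EFinP/measurable_funM; first exact: mf.
  exact: measurable_normal_pdf.
- rewrite [X in ae_eq _ _ _ X](_ : _ = (fun x => (f x)%:E * (normal_pdf m s x)%:E)%E)//.
  apply: ae_eqe_mul2l => /=.
  rewrite Radon_NikodymE//=; first exact: normal_prob_dominates.
  move=> dom; case: cid => /= h [h1 h2 h3].
  apply: integral_ae_eq => //=.
  + by apply/measurable_EFinP; exact: measurable_normal_pdf.
  + by move=> E E01 mE; rewrite -h3.
Qed.

End normal_integral.

(** * The Gaussian characteristic function *)

Section gaussian_integrals.
Context {R : realType}.
Local Notation mu := (@lebesgue_measure R).
Implicit Types c t x : R.

Lemma measurable_expR_sqr c : measurable_fun [set: R] (fun x => expR (- (c * x ^+ 2))).
Proof.
apply: measurableT_comp => //; apply: measurableT_comp => //.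
by apply: measurable_funM => //; exact: measurable_funX.
Qed.

Lemma integral_expR_sqr c : 0 < c ->
  (\int[mu]_x (expR (- (c * x ^+ 2)))%:E)%E = (Num.sqrt (pi / c))%:E.
Proof.
(* [s] is the standard deviation whose normal kernel is [exp (- c x^2)]; the total mass 1 of the
   normal density then gives the integral. *)
move=> c0; pose s : R := Num.sqrt (2 * c)^-1.
have c20 : 0 < (2 * c)^-1 by rewrite invr_gt0 mulr_gt0.
have s0 : s != 0 by rewrite gt_eqF// sqrtr_gt0.
have s2 : s ^+ 2 = (2 * c)^-1 by rewrite sqr_sqrtr// ltW.
have := integral_normal_pdf 0 s; rewrite normal_pdfE//.
have p0 : 0 < normal_peak s by exact: normal_peak_gt0.
under eq_integral do rewrite EFinM.
rewrite ge0_integralZl//=; last 3 first.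
- by apply/measurable_EFinP; exact: measurable_normal_fun.
- by move=> x _; rewrite lee_fin normal_fun_ge0.
- by rewrite lee_fin ltW.
move=> e1.
under eq_integral.
  move=> x _.
  rewrite (_ : expR _ = normal_fun 0 s x); last first.
    rewrite /normal_fun subr0 s2; congr expR; field.
    by rewrite gt_eqF.
  over.
have : ((normal_peak s)^-1%:E * ((normal_peak s)%:E * \int[mu]_x (normal_fun 0 s x)%:E) = (normal_peak s)^-1%:E)%E.
  by rewrite e1 mule1.
rewrite muleA -EFinM mulVf ?gt_eqF// mul1e => ->.
rewrite /normal_peak invrK s2; congr (Num.sqrt _)%:E; field.
by rewrite gt_eqF.
Qed.

Lemma integrable_expR_sqr c : 0 < c ->
  mu.-integrable [set: R] (fun x => (expR (- (c * x ^+ 2)))%:E).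
Proof.
move=> c0; apply/integrableP; split.
  by apply/measurable_EFinP; exact: measurable_expR_sqr.
under eq_integral do rewrite /= ger0_norm ?expR_ge0//.
by rewrite integral_expR_sqr// ltry.
Qed.

Lemma integrable_expR_sqr_le c (f : R -> R) : 0 < c -> measurable_fun [set: R] f ->
  (forall x, `|f x| <= expR (- (c * x ^+ 2))) ->
  mu.-integrable [set: R] (EFin \o f).
Proof.
move=> c0 mf fc; apply: le_integrable (integrable_expR_sqr c0) => //.
  exact/measurable_EFinP.
by move=> x _ /=; rewrite lee_fin (ger0_norm (expR_ge0 _)).
Qed.

Lemma norm_cos_le1 x : `|cos x| <= 1.
Proof. by rewrite ler_norml cos_geN1 cos_le1. Qed.

Lemma norm_sin_le1 x : `|sin x| <= 1.
Proof. by rewrite ler_norml sin_geN1 sin_le1. Qed.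

Lemma measurable_cos : measurable_fun [set: R] cos.
Proof. by apply: continuous_measurable_fun; exact: continuous_cos. Qed.

Lemma measurable_sin : measurable_fun [set: R] sin.
Proof. by apply: continuous_measurable_fun; exact: continuous_sin. Qed.

(** Since [(|x| - 2)^2 >= 0], one has [|x| <= 1 + x^2 / 4 <= exp (x^2 / 4)]. This dominates the
    [t]-derivative of the cosine integrand. *)
Lemma norm_id_expR_le x : `|x| * expR (- (2^-1 * x ^+ 2)) <= expR (- (4^-1 * x ^+ 2)).
Proof.
rewrite (_ : 2^-1 * x ^+ 2 = 4^-1 * x ^+ 2 + 4^-1 * x ^+ 2); last by field.
rewrite opprD expRD mulrA ler_piMl ?expR_ge0//.
rewrite expRN ler_pdivrMr ?expR_gt0// mul1r.
apply: le_trans (expR_ge1Dx _).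
have := sqr_ge0 (`|x| - 2); rewrite -(real_normK (num_real x)) sqrrB; lra.
Qed.

Lemma is_derive_sin_gauss t x :
  is_derive x (1 : R) (fun x : R => sin (t * x) * expR (- (2^-1 * x ^+ 2)))
    (t * (cos (t * x) * expR (- (2^-1 * x ^+ 2)))
     - x * (sin (t * x) * expR (- (2^-1 * x ^+ 2)))).
Proof.
by apply: is_derive_eq; rewrite /GRing.scale/=; field.
Qed.

Lemma integrable_cos_gauss t :
  mu.-integrable [set: R] (fun x => (cos (t * x) * expR (- (2^-1 * x ^+ 2)))%:E).
Proof.
apply: (@integrable_expR_sqr_le 2^-1) => //.
  apply: measurable_funM; last exact: measurable_expR_sqr.
  by apply: measurableT_comp; [exact: measurable_cos|exact: measurable_funM].
by move=> x; rewrite normrM (ger0_norm (expR_ge0 _)) ler_piMl ?expR_ge0 ?norm_cos_le1.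
Qed.

Lemma integrable_id_sin_gauss t :
  mu.-integrable [set: R] (fun x => (x * (sin (t * x) * expR (- (2^-1 * x ^+ 2))))%:E).
Proof.
apply: (@integrable_expR_sqr_le 4^-1) => //.
  apply: measurable_funM => //; apply: measurable_funM; last exact: measurable_expR_sqr.
  by apply: measurableT_comp; [exact: measurable_sin|exact: measurable_funM].
move=> x; apply: le_trans (norm_id_expR_le x).
rewrite !normrM (ger0_norm (expR_ge0 _)) ler_wpM2l// ler_piMl ?expR_ge0//.
exact: norm_sin_le1.
Qed.

(** Integration by parts: the derivative of [sin (t x) exp (- x^2 / 2)] has integral 0. This becomes
    the differential equation [C' = - t C] for the cosine transform. *)
Lemma Rintegral_id_sin_gauss t :
  \int[mu]_x (x * (sin (t * x) * expR (- (2^-1 * x ^+ 2)))) =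
  t * \int[mu]_x (cos (t * x) * expR (- (2^-1 * x ^+ 2))).
Proof.
pose D x := t * (cos (t * x) * expR (- (2^-1 * x ^+ 2)))
     - x * (sin (t * x) * expR (- (2^-1 * x ^+ 2))).
pose S x := sin (t * x) * expR (- (2^-1 * x ^+ 2)).
have iD : mu.-integrable [set: R] (EFin \o D).
  rewrite /comp/D; under eq_fun do rewrite EFinB.
  apply: integrableB => //; last exact: integrable_id_sin_gauss.
  under eq_fun do rewrite EFinM.
  by apply: integrableZl => //; exact: integrable_cos_gauss.
suff : \int[mu]_x D x = 0.
  rewrite RintegralB//; last 2 first.
  - rewrite /comp; under eq_fun do rewrite EFinM.
    by apply: integrableZl => //; exact: integrable_cos_gauss.
  - exact: integrable_id_sin_gauss.
  rewrite RintegralZl//; last exact: integrable_cos_gauss.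
  by move/eqP; rewrite subr_eq0 => /eqP ->.
have mD : measurable_fun [set: R] D by apply/measurable_EFinP; exact: measurable_int iD.
have cD : continuous D.
  move=> x; apply: cvgB; apply: cvgM => //; try exact: cvg_cst.
  - apply: cvgM; apply: continuous_comp => //; try exact: continuous_expR.
    + by apply: cvgM; [exact: cvg_cst|exact: cvg_id].
    + exact: continuous_cos.
    + apply: cvgN; apply: cvgM; [exact: cvg_cst|exact: exprn_continuous].
  - apply: cvgM; apply: continuous_comp => //; try exact: continuous_expR.
    + by apply: cvgM; [exact: cvg_cst|exact: cvg_id].
    + exact: continuous_sin.
    + apply: cvgN; apply: cvgM; [exact: cvg_cst|exact: exprn_continuous].
pose I n : set R := `[- n.+1%:R, n.+1%:R]%classic.
have lim1 : (\int[mu]_(x in I n) (D x)%:E)%E @[n --> \oo] --> (\int[mu]_x (D x)%:E)%E.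
  have [|||||/= _ _] := @dominated_convergence _ _ _ mu setT measurableT
    (fun n => (EFin \o D) \_ (I n)) (EFin \o D) (abse \o (EFin \o D)).
  - move=> n; apply/(measurable_restrict _ _) => //; rewrite ?setTI.
      exact: measurable_itv.
    by apply: measurable_funTS; apply/measurable_EFinP.
  - exact/measurable_EFinP.
  - apply: aeW => x _; apply: cvg_near_cst.
    have [N _ HN] := nbhs_infty_ger (R := R) `|x|.
    exists N => // n Nn /=; rewrite patchE mem_set// /I/=.
    by rewrite in_itv/= -ler_norml (le_trans (HN _ Nn))// ler_nat.
  - exact: integrable_abse.
  - apply: aeW => x n _; rewrite patchE; case: ifP => // _ /=.
    by rewrite normr0 lee_fin.
  rewrite [X in X @ _ --> _ -> _](_ : _ = (fun n => \int[mu]_(x in I n) (D x)%:E)%E)//.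
  by apply/funext => n; rewrite [RHS]integral_mkcond.
(* [S] is odd, so its increment over the symmetric interval is twice its value at the right end. *)
have FTC n : (\int[mu]_(x in I n) (D x)%:E)%E = (2 * S n.+1%:R)%:E.
  rewrite (@continuous_FTC2 _ D S).
  - rewrite -EFinB /S mulrN sinN sqrrN; congr EFin; ring.
  - by rewrite (@lt_trans _ _ 0)// oppr_lt0.
  - exact: continuous_subspaceT.
  - split.
    + by move=> x _; have := is_derive_sin_gauss t x => -[].
    + apply: cvg_at_right_filter; apply: differentiable_continuous.
      by apply/derivable1_diffP; have := is_derive_sin_gauss t (- n.+1%:R) => -[].
    + apply: cvg_at_left_filter; apply: differentiable_continuous.
      by apply/derivable1_diffP; have := is_derive_sin_gauss t (n.+1%:R) => -[].
  - by move=> x _; rewrite derive1E; have := is_derive_sin_gauss t x => -[].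
have lim2 : (2 * S n.+1%:R) @[n --> \oo] --> (0 : R).
  apply/norm_cvg0P.
  apply: (@squeeze_cvgr _ _ _ _ (cst 0) (fun n => 4 * harmonic n)).
  - near=> n; rewrite normr_ge0/= normrM ger0_norm// /S normrM (ger0_norm (expR_ge0 _)).
    rewrite (_ : 4 = 2 * 2)// -?mulrA ?ler_pM2l//; last by rewrite -natrM.
    apply: (@le_trans _ _ (expR (- (2^-1 * n.+1%:R ^+ 2)))).
      by rewrite ler_piMl ?expR_ge0// norm_sin_le1.
    rewrite expRN -[leLHS]div1r ler_pdivrMr ?expR_gt0// /harmonic/= mulrAC.
    rewrite ler_pdivlMr ?ltr0n// mul1r.
    have := expR_ge1Dx (2^-1 * n.+1%:R ^+ 2 : R).
    have := ler0n R n.+1; have := sqr_ge0 (n.+1%:R - 1 : R); rewrite sqrrB; lra.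
  - exact: cvg_cst.
  - rewrite -[X in _ --> X](mulr0 4); apply: cvgM; first exact: cvg_cst.
    exact: cvg_harmonic.
move: lim1; rewrite (_ : (fun n => _) = (fun n => (2 * S n.+1%:R)%:E)); last first.
  by apply/funext => n; exact: FTC.
move=> lim1.
have lim3 : (2 * S n.+1%:R)%:E @[n --> \oo] --> 0%E.
  by apply: cvg_EFin => //; exact: nearW.
by rewrite /Rintegral (cvg_unique _ lim1 lim3).
Unshelve. all: by end_near. Qed.

Lemma is_derive_Rintegral_cos_gauss t :
  is_derive t (1 : R) (fun t => \int[mu]_x (cos (t * x) * expR (- (2^-1 * x ^+ 2))))
    (- (t * \int[mu]_x (cos (t * x) * expR (- (2^-1 * x ^+ 2))))).
Proof.
pose f t x : R := cos (t * x) * expR (- (2^-1 * x ^+ 2)).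
have df s x : is_derive s (1 : R) (f ^~ x) (- (x * (sin (s * x) * expR (- (2^-1 * x ^+ 2))))).
  by apply: is_derive_eq; rewrite /GRing.scale/=; ring.
have d1f s x : partial1of2 f s x = - (x * (sin (s * x) * expR (- (2^-1 * x ^+ 2)))).
  by rewrite partial1of2E; have := df s x => -[].
pose G x : R := expR (- (4^-1 * x ^+ 2)).
have It : `]t - 1, t + 1[%classic t by rewrite /= in_itv/= ltrDl ltrBlDr ltrDl ltr01.
have intf s : `]t - 1, t + 1[%classic s -> mu.-integrable [set: R] (EFin \o f s).
  by move=> _; exact: integrable_cos_gauss.
have derf s x : `]t - 1, t + 1[%classic s -> [set: R] x -> derivable (f ^~ x) s 1.
  by move=> _ _; have := df s x => -[].
have G0 x : 0 <= G x by exact: expR_ge0.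
have intG : mu.-integrable [set: R] (EFin \o G) by exact: integrable_expR_sqr.
have Gub s x : `]t - 1, t + 1[%classic s -> [set: R] x -> `|partial1of2 f s x| <= G x.
  move=> _ _; rewrite d1f normrN; apply: le_trans (norm_id_expR_le x).
  rewrite !normrM (ger0_norm (expR_ge0 _)) ler_wpM2l// ler_piMl ?expR_ge0//.
  exact: norm_sin_le1.
apply: DeriveDef.
  exact: (derivable_under_integral measurableT It intf derf G0 intG Gub).
rewrite -derive1E (differentiation_under_integral measurableT It intf derf G0 intG Gub).
rewrite -Rintegral_id_sin_gauss.
under eq_Rintegral do rewrite d1f -mulN1r.
by rewrite RintegralZl ?mulN1r//; exact: integrable_id_sin_gauss.
Qed.

(** The transform solves [C' = - t C], hence [C t * exp (t^2 / 2)] is constant; at 0 it is the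
    Gaussian integral. *)
Lemma Rintegral_cos_gauss t :
  \int[mu]_x (cos (t * x) * expR (- (2^-1 * x ^+ 2))) =
  expR (- (2^-1 * t ^+ 2)) * Num.sqrt (pi *+ 2).
Proof.
pose C t := \int[mu]_x (cos (t * x) * expR (- (2^-1 * x ^+ 2))).
have dC s : is_derive s (1 : R) C (- (s * C s)) by exact: is_derive_Rintegral_cos_gauss.
have dh s : is_derive s (1 : R) (fun s => C s * expR (2^-1 * s ^+ 2)) 0.
  by apply: is_derive_eq; rewrite /GRing.scale/=; field.
have := is_derive_0_is_cst t 0 dh; rewrite expr0n mulr0 expR0 mulr1.
have -> : C 0 = Num.sqrt (pi *+ 2).
  rewrite /C /Rintegral; under eq_integral do rewrite mul0r cos0 mul1r.
  by rewrite integral_expR_sqr//= invrK mulr_natr.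
move=> <-; rewrite mulrC -mulrA -expRD subrr expR0 mulr1.
by [].
Qed.

End gaussian_integrals.

Section standard_normal.
Context {R : realType}.
Local Notation mu := (@lebesgue_measure R).
Local Notation Phi := (@normal_prob R 0 1).
Implicit Types b c t x : R.

Lemma normal_pdf01E x :
  normal_pdf 0 1 x = expR (- (2^-1 * x ^+ 2)) * (Num.sqrt (pi *+ 2))^-1.
Proof.
rewrite normal_pdfE// /normal_peak expr1n mul1r mulrC; congr (_ * _).
by rewrite /normal_fun subr0 expr1n; congr expR; field.
Qed.

Lemma Rintegral_normal01 (f : R -> R) : bmfun f ->
  \int[Phi]_x f x = \int[mu]_x (f x * normal_pdf 0 1 x).
Proof. by move=> bf; rewrite /Rintegral integral_normal_prob. Qed.

Lemma sqrt_2pi_gt0 : 0 < Num.sqrt (pi *+ 2) :> R.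
Proof. by rewrite sqrtr_gt0 mulrn_wgt0// pi_gt0. Qed.

Lemma bmfun_cos d (T : measurableType d) (f : T -> R) :
  measurable_fun [set: T] f -> bmfun (fun w => cos (f w)).
Proof.
move=> mf; split; last by exists 1 => w; exact: norm_cos_le1.
by apply: measurableT_comp => //; exact: measurable_cos.
Qed.

Lemma bmfun_sin d (T : measurableType d) (f : T -> R) :
  measurable_fun [set: T] f -> bmfun (fun w => sin (f w)).
Proof.
move=> mf; split; last by exists 1 => w; exact: norm_sin_le1.
by apply: measurableT_comp => //; exact: measurable_sin.
Qed.

Lemma bmfun_expRN d (T : measurableType d) (f : T -> R) :
  measurable_fun [set: T] f -> (forall w, 0 <= f w) -> bmfun (fun w => expR (- f w)).
Proof.
move=> mf f0; apply: bmfun_le1.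
  by apply: measurableT_comp => //; exact: measurableT_comp.
by move=> x; rewrite expR_ge0/= -expR0 ler_expR oppr_le0.
Qed.

Lemma Rintegral_normal01_cos t : \int[Phi]_n cos (t * n) = expR (- (2^-1 * t ^+ 2)).
Proof.
rewrite Rintegral_normal01; last by apply: bmfun_cos; exact: measurable_funM.
under eq_Rintegral do rewrite normal_pdf01E mulrA.
rewrite RintegralZr//; last exact: integrable_cos_gauss.
by rewrite Rintegral_cos_gauss mulfK// gt_eqF// sqrt_2pi_gt0.
Qed.

Lemma Rintegral_normal01_gauss b : 0 <= b ->
  \int[Phi]_n expR (- (b * n ^+ 2)) = Num.sqrt (1 + 2 * b)^-1.
Proof.
move=> b0; rewrite Rintegral_normal01; last first.
  apply: bmfun_expRN; last by move=> x; rewrite mulr_ge0// sqr_ge0.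
  by apply: measurable_funM => //; exact: measurable_funX.
have b20 : 0 < 1 + 2 * b by rewrite ltr_pwDl// mulr_ge0.
under eq_Rintegral.
  move=> x _; rewrite normal_pdf01E mulrA -expRD -opprD -mulrDl.
  over.
have bh : 0 < b + 2^-1 by rewrite ltr_wpDl.
rewrite RintegralZr//; last exact: integrable_expR_sqr.
rewrite /Rintegral integral_expR_sqr//=.
have pi20 : 0 <= pi *+ 2 :> R by rewrite mulrn_wge0 ?pi_ge0.
rewrite -[X in _ * X = _](sqrtrV pi20) -sqrtrM; last by rewrite divr_ge0 ?pi_ge0// ltW.
have := pi_gt0 R; move: (pi : R) => p p0.
congr Num.sqrt; field.
by rewrite !gt_eqF//; lra.
Qed.

End standard_normal.

Section gaussian_law.
Context {R : realType} d (T : measurableType d) (Q : probability T R).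
Local Notation Phi := (@normal_prob R 0 1).

Lemma normal0_rv_Rintegral (X : T -> R) (f : R -> R) :
  normal0_rv Q X 1 -> bmfun f -> \int[Q]_w f (X w) = \int[Phi]_x f x.
Proof.
move=> [mX lX] [mf [M fM]]; rewrite /Rintegral; congr fine.
have mX' : @measurable_fun _ _ T (measurableTypeR R) [set: T] X by exact: mX.
pose X0 : {mfun T >-> measurableTypeR R} := @mfun_Sub _ _ T (measurableTypeR R) X (mem_set mX').
have <- := @eq_measure_integral _ (measurableTypeR R) R setT Phi (distribution Q X0) (EFin \o f).
  rewrite (@integral_pushforward _ _ _ _ R X0 mX' Q setT (EFin \o f))//.
  - exact/measurable_EFinP.
  - by apply: bmfun_integrable; split; [exact: measurableT_comp|exists M].
by move=> A mA _; have := lX A mA; rewrite ltr01 sqrtr1.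
Qed.

(** The hypothesis on [- X] expresses symmetry: it makes [E sin (t X)] its own opposite, so only the
    cosine term of the addition formula survives. *)
Lemma normal0_rv_cos (X : T -> R) (t th : R) :
  normal0_rv Q X 1 -> normal0_rv Q (fun w => - X w) 1 ->
  \int[Q]_w cos (t * X w + th) = expR (- (2^-1 * t ^+ 2)) * cos th.
Proof.
move=> nX nNX; have [mX _] := nX.
have mt : measurable_fun [set: R] (fun x : R => t * x) by exact: measurable_funM.
have mtX : measurable_fun [set: T] (fun w => t * X w) by exact: measurable_funM.
have bs := bmfun_sin mt; have bc := bmfun_cos mt.
have bsX := bmfun_sin mtX; have bcX := bmfun_cos mtX.
have sin0 : \int[Q]_w sin (t * X w) = 0.
  have e1 := normal0_rv_Rintegral nX bs.
  have := normal0_rv_Rintegral nNX bs.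
  rewrite -e1; under eq_Rintegral do rewrite mulrN sinN -mulN1r.
  by rewrite bmRintegralZl// mulN1r => e; lra.
under eq_Rintegral do rewrite cosD.
rewrite bmRintegralB; try by apply: bmfunM => //; exact: bmfun_cst.
rewrite !bmRintegralZr// sin0 mul0r subr0.
by rewrite (normal0_rv_Rintegral nX bc) Rintegral_normal01_cos.
Qed.

End gaussian_law.

(** * Gaussian families *)

Section gaussian_family.
Context {R : realType} d (T : measurableType d) (Q : probability T R) (q : nat).
Variables (X : T -> R) (W : 'I_q -> T -> R).
Local Notation Phi := (@normal_prob R 0 1).
Local Notation lin a0 c := (fun w => a0 * X w + \sum_(l < q) c l * W l w).

Hypothesis gaussXW : forall (a0 : R) (c : 'I_q -> R),
  normal0_rv Q (lin a0 c) (a0 ^+ 2 + \sum_(l < q) c l ^+ 2).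

Lemma normal0_gaussW i : normal0_rv Q (W i) 1.
Proof.
have := gaussXW 0 (fun l => (l == i)%:R).
rewrite (_ : (fun w => _) = W i); last first.
  apply/funext => w; rewrite mul0r add0r (bigD1 i)//= eqxx mul1r big1 ?addr0//.
  by move=> l /negbTE ->; rewrite mul0r.
suff -> : 0 ^+ 2 + \sum_(l < q) (l == i)%:R ^+ 2 = 1 :> R by [].
rewrite [\sum_(l < q) _](bigD1 i)//= [X in _ + (_ + X)]big1.
  by rewrite eqxx expr1n expr0n add0r addr0.
by move=> l /negbTE ->; rewrite expr0n.
Qed.

Lemma normal0_gaussX : normal0_rv Q X 1.
Proof.
have := gaussXW 1 (fun=> 0).
rewrite (_ : (fun w => _) = X); last first.
  by apply/funext => w; rewrite mul1r big1 ?addr0// => l _; rewrite mul0r.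
by rewrite expr1n big1 ?addr0// => l _; rewrite expr0n.
Qed.

Lemma measurable_gaussX : measurable_fun [set: T] X.
Proof. by have [] := normal0_gaussX. Qed.

Lemma measurable_gaussW i : measurable_fun [set: T] (W i).
Proof. by have [] := normal0_gaussW i. Qed.

Lemma measurable_gauss_lin a0 c : measurable_fun [set: T] (lin a0 c).
Proof. by have [] := gaussXW a0 c. Qed.

(** Dividing by the standard deviation [s] reduces to unit variance at frequency [s]; the
    coefficients divided by [- s] supply the symmetry. If the variance is 0, all coefficients vanish
    and the cosine is constant. *)
Lemma gauss_charfun a0 c th :
  \int[Q]_w cos (lin a0 c w + th) =
  expR (- (2^-1 * (a0 ^+ 2 + \sum_(l < q) c l ^+ 2))) * cos th.
Proof.
set v := a0 ^+ 2 + _.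
have c2ge0 : 0 <= \sum_(l < q) c l ^+ 2 by apply: sumr_ge0 => l _; exact: sqr_ge0.
have v0 : 0 <= v by rewrite addr_ge0// sqr_ge0.
have [v0'|vn0] := eqVneq v 0.
  have /eqP := v0'; rewrite paddr_eq0 ?sqr_ge0// sqrf_eq0 => /andP[/eqP a00].
  rewrite psumr_eq0; last by move=> l _; exact: sqr_ge0.
  move=> /allP c0; rewrite v0' mulr0 oppr0 expR0 mul1r.
  rewrite -[RHS](Rintegral_cst1 Q); apply: eq_Rintegral => w _.
  rewrite a00 mul0r big1 ?add0r// => l _.
  have := c0 l (mem_index_enum l); rewrite sqrf_eq0 => /eqP ->.
  by rewrite mul0r.
pose s := Num.sqrt v.
have s0 : s != 0 by rewrite gt_eqF// sqrtr_gt0 lt_neqAle eq_sym vn0.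
have s2 : s ^+ 2 = v by rewrite sqr_sqrtr.
have lins k : (fun w => k / s * a0 * X w + \sum_(l < q) (k / s * c l) * W l w) =
    (fun w => k / s * lin a0 c w).
  apply/funext => w; rewrite mulrDr mulr_sumr mulrA; congr (_ + _).
  by apply: eq_bigr => l _; rewrite mulrA.
have var k : k ^+ 2 = 1 ->
    (k / s * a0) ^+ 2 + \sum_(l < q) (k / s * c l) ^+ 2 = 1.
  move=> k2; rewrite exprMn; under eq_bigr do rewrite exprMn.
  by rewrite -mulr_sumr -mulrDr -/v exprMn k2 mul1r exprVn s2 mulVf.
have := gaussXW (1 / s * a0) (fun l => 1 / s * c l).
rewrite lins var ?expr1n// => n1.
have := gaussXW (-1 / s * a0) (fun l => -1 / s * c l).
rewrite lins var ?sqrrN ?expr1n// => n2.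
have n2' : normal0_rv Q (fun w => - (1 / s * lin a0 c w)) 1.
  by move: n2; under eq_fun do rewrite !mulNr.
rewrite -s2 -(normal0_rv_cos s th n1 n2').
apply: eq_Rintegral => w _; congr cos; congr (_ + _).
by rewrite mulrA mul1r divff// mul1r.
Qed.

(** The cutoff [k] serves an induction over coordinates; at [k = q] this is the chi-square
    variable. *)
Definition gauss_sqsum k w := \sum_(l < q | (l < k)%N) W l w ^+ 2.

Lemma gauss_sqsum_ge0 k w : 0 <= gauss_sqsum k w.
Proof. by apply: sumr_ge0 => l _; exact: sqr_ge0. Qed.

Lemma measurable_gauss_sqsum k : measurable_fun [set: T] (gauss_sqsum k).
Proof.
rewrite (_ : gauss_sqsum k = fun w => \sum_(l < q) if (l < k)%N then W l w ^+ 2 else 0); last first.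
  by apply/funext => w; exact: big_mkcond.
apply: measurable_sum => l; case: (l < k)%N; last exact: measurable_cst.
by apply: measurable_funX; exact: measurable_gaussW.
Qed.

Lemma bmfun_expR_sqsum b k : 0 <= b -> bmfun (fun w => expR (- (b * gauss_sqsum k w))).
Proof.
move=> b0; apply: bmfun_expRN; last by move=> w; rewrite mulr_ge0// gauss_sqsum_ge0.
by apply: measurable_funM => //; exact: measurable_gauss_sqsum.
Qed.

Lemma measurable_sndR : measurable_fun [set: T * measurableTypeR R]
  (fun z : T * measurableTypeR R => z.2 : R).
Proof. exact: measurable_snd. Qed.

(** The factor [exp (- Y^2 / 2)] is the mean of [cos (Y n)] for a standard normal [n]. The product
    formula for cosines then trades the quadratic exponent for the linear phases [Z + n Y] and
    [Z - n Y]. *)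
Lemma Fubini_cos_normal01 (B Y Z : T -> R) : bmfun B ->
  measurable_fun [set: T] Y -> measurable_fun [set: T] Z ->
  \int[Q]_w (B w * expR (- (2^-1 * Y w ^+ 2)) * cos (Z w)) =
  \int[Phi]_n (2^-1 * \int[Q]_w (B w * cos (Z w + n * Y w))
             + 2^-1 * \int[Q]_w (B w * cos (Z w - n * Y w))).
Proof.
move=> bB mY mZ; have [mB [M BM]] := bB.
transitivity (\int[Q]_w \int[Phi]_n (B w * cos (Z w) * cos (Y w * n))).
  apply: eq_Rintegral => w _; rewrite bmRintegralZl; last first.
    by apply: bmfun_cos; exact: measurable_funM.
  by rewrite Rintegral_normal01_cos mulrAC.
rewrite bmRintegral_Fubini; last first.
  apply: bmfunM; first apply: bmfunM.
  - split; last by exists M => z; exact: BM.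
    exact: measurableT_comp mB measurable_fst.
  - by apply: bmfun_cos; exact: measurableT_comp mZ measurable_fst.
  - apply: bmfun_cos; apply: measurable_funM; last exact: measurable_sndR.
    exact: measurableT_comp mY measurable_fst.
apply: eq_Rintegral => n _.
have bp s : bmfun (fun w => B w * cos (Z w + s * Y w)).
  apply: bmfunM => //; apply: bmfun_cos; apply: measurable_funD => //.
  exact: measurable_funM.
have bm : bmfun (fun w => B w * cos (Z w - n * Y w)).
  by have := bp (- n); under eq_fun do rewrite mulNr.
rewrite -!bmRintegralZl// -bmRintegralD//; try by apply: bmfunM => //; exact: bmfun_cst.
by apply: eq_Rintegral => w _; rewrite cosD cosB (mulrC (Y w)); field.
Qed.

(** Each squared coordinate is linearised in turn: the auxiliary normal [n] turns [W k] into a term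
    with coefficient [n b] or [- n b], which lands on a coefficient that was 0. Averaging over [n]
    gives one factor [(1 + b^2)^(- 1/2)]. Coefficients at indices from [k] on stay arbitrary so that
    the induction hypothesis covers the new one. *)
Lemma gauss_sqsum_charfun k b a0 (c : 'I_q -> R) th : (k <= q)%N ->
  (forall l : 'I_q, (l < k)%N -> c l = 0) ->
  \int[Q]_w (expR (- (2^-1 * b ^+ 2 * gauss_sqsum k w)) * cos (lin a0 c w + th)) =
  (Num.sqrt (1 + b ^+ 2)^-1) ^+ k *
  (expR (- (2^-1 * (a0 ^+ 2 + \sum_(l < q) c l ^+ 2))) * cos th).
Proof.
have hb0 : 0 <= 2^-1 * b ^+ 2 by rewrite mulr_ge0// sqr_ge0.
elim: k c th => [|k IHk] c th kq ck.
  rewrite expr0 mul1r -gauss_charfun; apply: eq_Rintegral => w _.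
  by rewrite /gauss_sqsum big_pred0// mulr0 oppr0 expR0 mul1r.
pose i := Ordinal kq.
have Sk w : gauss_sqsum k.+1 w = gauss_sqsum k w + W i w ^+ 2.
  rewrite /gauss_sqsum (bigD1 i)//= addrC; congr (_ + _).
  apply: eq_bigl => l; rewrite ltnS leq_eqVlt -val_eqE/=.
  by case: ltngtP.
transitivity (\int[Q]_w (expR (- (2^-1 * b ^+ 2 * gauss_sqsum k w)) *
    expR (- (2^-1 * (b * W i w) ^+ 2)) * cos (lin a0 c w + th))).
  apply: eq_Rintegral => w _; rewrite Sk -expRD; congr (expR _ * _); ring.
have mbW : measurable_fun [set: T] (fun w => b * W i w).
  by apply: measurable_funM => //; exact: measurable_gaussW.
have mL : measurable_fun [set: T] (fun w => lin a0 c w + th).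
  by apply: measurable_funD => //; exact: measurable_gauss_lin.
rewrite (Fubini_cos_normal01 (bmfun_expR_sqsum k hb0) mbW mL).
pose c' s l := if l == i then s else c l.
have linc' s w : lin a0 (c' s) w = lin a0 c w + s * W i w.
  rewrite /= (bigD1 i)//= [in RHS](bigD1 i)//= {1}/c' eqxx ck//= mul0r add0r.
  rewrite -addrA [s * _ + _]addrC; congr (_ + (_ + _)).
  by apply: eq_bigr => l /negbTE li; rewrite /c' li.
have sumc' s : \sum_(l < q) c' s l ^+ 2 = \sum_(l < q) c l ^+ 2 + s ^+ 2.
  rewrite (bigD1 i)//= [in RHS](bigD1 i)//= {1}/c' eqxx ck//= expr0n add0r addrC.
  by congr (_ + _); apply: eq_bigr => l /negbTE li; rewrite /c' li.
have IH s : \int[Q]_w (expR (- (2^-1 * b ^+ 2 * gauss_sqsum k w)) *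
      cos (lin a0 c w + th + s * W i w)) =
    (Num.sqrt (1 + b ^+ 2)^-1) ^+ k *
    (expR (- (2^-1 * (a0 ^+ 2 + \sum_(l < q) c l ^+ 2))) * cos th) *
    expR (- (2^-1 * s ^+ 2)).
  transitivity (\int[Q]_w (expR (- (2^-1 * b ^+ 2 * gauss_sqsum k w)) *
      cos (lin a0 (c' s) w + th))).
    by apply: eq_Rintegral => w _; rewrite linc' addrAC.
  rewrite IHk ?(ltnW kq)//; last first.
    move=> l lk; rewrite /c' ifF; first by rewrite ck// ltnS ltnW.
    by apply/negbTE; rewrite -val_eqE/= neq_ltn lk.
  by rewrite sumc' addrA mulrDr opprD expRD; ring.
transitivity (\int[Phi]_n ((Num.sqrt (1 + b ^+ 2)^-1) ^+ k *
    (expR (- (2^-1 * (a0 ^+ 2 + \sum_(l < q) c l ^+ 2))) * cos th) *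
    expR (- (2^-1 * b ^+ 2 * n ^+ 2)))).
  apply: eq_Rintegral => n _.
  rewrite (_ : \int[Q]_w (_ * cos (_ + n * _)) = \int[Q]_w
      (expR (- (2^-1 * b ^+ 2 * gauss_sqsum k w)) *
       cos (lin a0 c w + th + n * b * W i w))); last first.
    by apply: eq_Rintegral => w _; congr (_ * cos (_ + _)); rewrite mulrA.
  rewrite (_ : \int[Q]_w (_ * cos (_ - n * _)) = \int[Q]_w
      (expR (- (2^-1 * b ^+ 2 * gauss_sqsum k w)) *
       cos (lin a0 c w + th + - (n * b) * W i w))); last first.
    by apply: eq_Rintegral => w _; congr (_ * cos (_ + _)); rewrite mulrA mulNr.
  rewrite !IH sqrrN exprMn (mulrC (n ^+ 2)) -(mulrA 2^-1 (b ^+ 2)).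
  rewrite -mulrDl (_ : 2^-1 + 2^-1 = 1) ?mul1r//; lra.
rewrite bmRintegralZl; last first.
  apply: bmfun_expRN; last by move=> x; rewrite mulr_ge0// sqr_ge0.
  by apply: measurable_funM => //; exact: measurable_funX.
rewrite Rintegral_normal01_gauss// (_ : 2 * (2^-1 * b ^+ 2) = b ^+ 2); last by field.
by rewrite mulrC mulrA -exprS.
Qed.

End gaussian_family.

Section gaussian_kernel.
Context {R : realType} d (T : measurableType d) (Q : probability T R) (q : nat).
Variables (X : T -> R) (W : 'I_q -> T -> R).
Local Notation lin a0 c := (fun w => a0 * X w + \sum_(l < q) c l * W l w).
Hypothesis gaussXW : forall (a0 : R) (c : 'I_q -> R),
  normal0_rv Q (lin a0 c) (a0 ^+ 2 + \sum_(l < q) c l ^+ 2).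
Local Notation S := (gauss_sqsum W q).

Lemma gauss_laplace_cos b a th : 0 <= b ->
  \int[Q]_w (expR (- (b * S w)) * cos (a * X w + th)) =
  (Num.sqrt (1 + 2 * b)^-1) ^+ q * (expR (- (2^-1 * a ^+ 2)) * cos th).
Proof.
move=> b0; have b20 : 0 <= 2 * b by rewrite mulr_ge0.
have := gauss_sqsum_charfun gaussXW (Num.sqrt (2 * b)) a (c := fun=> 0) th (leqnn q) (fun _ _ => erefl).
rewrite /= (_ : \sum_(l < q) (0 : R) ^+ 2 = 0); last first.
  by rewrite big1// => l _; rewrite expr0n.
rewrite sqr_sqrtr// addr0 [2^-1 * (2 * b)]mulrA mulVf// mul1r => <-.
apply: eq_Rintegral => w _; rewrite big1 ?addr0// => l _; exact: mul0r.
Qed.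

Lemma gauss_laplace b : 0 <= b ->
  \int[Q]_w expR (- (b * S w)) = (Num.sqrt (1 + 2 * b)^-1) ^+ q.
Proof.
move=> b0; have := gauss_laplace_cos 0 0 b0.
rewrite cos0 expr0n mulr0 oppr0 expR0 !mulr1 => <-.
by apply: eq_Rintegral => w _; rewrite mul0r addr0 cos0 mulr1.
Qed.

(** Once the bump in [X] is written as a mixture of cosines, [gauss_laplace_cos] applies, and there
    the factor depending on [b] is separate from the factor depending on the frequency. *)
Lemma gauss_laplace_kernel b a y : 0 <= b ->
  \int[Q]_w (expR (- (b * S w)) * expR (- (2^-1 * (a * (X w - y)) ^+ 2))) =
  \int[Q]_w expR (- (b * S w)) * \int[Q]_w expR (- (2^-1 * (a * (X w - y)) ^+ 2)).
Proof.
move=> b0; have mX := measurable_gaussX gaussXW.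
(* The second factor is the same for all [c]; [c = 0] identifies it with the expectation of the bump
   alone. *)
have main c : 0 <= c ->
    \int[Q]_w (expR (- (c * S w)) * expR (- (2^-1 * (a * (X w - y)) ^+ 2))) =
    (Num.sqrt (1 + 2 * c)^-1) ^+ q *
    \int[normal_prob 0 1]_n (expR (- (2^-1 * (n * a) ^+ 2)) * cos (n * a * y)).
  move=> c0.
  transitivity (\int[Q]_w (expR (- (c * S w)) * expR (- (2^-1 * (a * (X w - y)) ^+ 2)) * cos 0)).
    by apply: eq_Rintegral => w _; rewrite cos0 mulr1.
  rewrite (Fubini_cos_normal01 _ (Z := fun=> 0)) //; last 2 first.
  - exact: (bmfun_expR_sqsum gaussXW).
  - by apply: measurable_funM => //; exact: measurable_funB.
  rewrite -bmRintegralZl; last first.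
    apply: bmfunM.
      apply: bmfun_expRN; last by move=> n; rewrite mulr_ge0// sqr_ge0.
      by apply: measurable_funM => //; apply: measurable_funX; exact: measurable_funM.
    by apply: bmfun_cos; apply: measurable_funM => //; exact: measurable_funM.
  apply: eq_Rintegral => n _.
  rewrite (_ : \int[Q]_w (_ * cos (0 + n * _)) =
      \int[Q]_w (expR (- (c * S w)) * cos (n * a * X w + - (n * a * y)))); last first.
    by apply: eq_Rintegral => w _; congr (_ * cos _); ring.
  rewrite (_ : \int[Q]_w (_ * cos (0 - n * _)) =
      \int[Q]_w (expR (- (c * S w)) * cos (- (n * a) * X w + n * a * y))); last first.
    by apply: eq_Rintegral => w _; congr (_ * cos _); ring.
  rewrite !gauss_laplace_cos// cosN sqrrN.
  by rewrite -mulrDl (_ : 2^-1 + 2^-1 = 1) ?mul1r//; lra.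
rewrite main// gauss_laplace//; congr (_ * _).
have := main 0 (lexx 0); rewrite mulr0 addr0 invr1 sqrtr1 expr1n mul1r => <-.
apply: eq_Rintegral => w _.
by rewrite mul0r oppr0 expR0 mul1r.
Qed.

End gaussian_kernel.

(** * Bernstein polynomials, and independence from factorised Laplace transforms *)

Section bernstein.
Context {R : realType}.
Implicit Types (f g : nat -> R) (v : R).

(* The n-th Bernstein operator, by the recursion of a binomial random walk *)
Fixpoint bernstein n f : {poly R} :=
  if n is n'.+1 then
    'X * bernstein n' (fun i => f i.+1) + (1 - 'X) * bernstein n' f
  else (f 0%N)%:P.

Lemma bernsteinS n f v : (bernstein n.+1 f).[v] =
  v * (bernstein n (fun i => f i.+1)).[v] + (1 - v) * (bernstein n f).[v].
Proof. by rewrite /= !hornerE. Qed.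

Lemma bernstein_lin n f g (a : R) v :
  (bernstein n (fun i => a * f i + g i)).[v] = a * (bernstein n f).[v] + (bernstein n g).[v].
Proof.
elim: n f g => [|n IHn] f g; first by rewrite /= !hornerE.
by rewrite !bernsteinS !IHn; ring.
Qed.

Lemma bernstein_cst n (a : R) v : (bernstein n (fun=> a)).[v] = a.
Proof.
elim: n => [|n IHn]; first by rewrite /= hornerE.
by rewrite bernsteinS IHn; ring.
Qed.

Lemma bernstein_le n f g v : 0 <= v <= 1 -> (forall i, f i <= g i) ->
  (bernstein n f).[v] <= (bernstein n g).[v].
Proof.
move=> /andP[v0 v1]; elim: n f g => [|n IHn] f g fg; first by rewrite /= !hornerE.
by rewrite !bernsteinS lerD// ler_wpM2l// ?subr_ge0// IHn.
Qed.

(** Mean square of a binomial variable about [a]: variance plus squared bias. The centre is left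
    free because one step of the recursion shifts [a] to [a - 1]. *)
Lemma bernstein_var n (a : R) v :
  (bernstein n (fun i => (i%:R - a) ^+ 2)).[v] = n%:R * v * (1 - v) + (n%:R * v - a) ^+ 2.
Proof.
elim: n a => [|n IHn] a; first by rewrite /= hornerE; ring.
rewrite bernsteinS IHn.
have -> : (fun i => (i.+1%:R - a) ^+ 2) = (fun i => (i%:R - (a - 1)) ^+ 2).
  by apply/funext => i; rewrite -natr1; congr (_ ^+ 2); ring.
by rewrite IHn -natr1; ring.
Qed.

Lemma bernstein_bound n f (M : R) v : 0 <= v <= 1 -> (forall i, `|f i| <= M) ->
  `|(bernstein n f).[v]| <= M.
Proof.
move=> v01 fM; rewrite ler_norml.
rewrite -{1}(bernstein_cst n (- M) v) -{2}(bernstein_cst n M v).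
by rewrite !bernstein_le// => i; have := fM i; rewrite ler_norml => /andP[].
Qed.

(** Chebyshev's inequality for the binomial law. Convergence is pointwise and interior because in
    the application [kappa] is [K] composed with [- ln], about which nothing is known near 0 and
    1. *)
Lemma cvg_bernstein (kappa : R -> R) (M v : R) :
  0 < v < 1 -> (forall x, `|kappa x| <= M) -> {for v, continuous kappa} ->
  (bernstein n.+1 (fun i => kappa (i%:R / n.+1%:R))).[v] @[n --> \oo] --> kappa v.
Proof.
move=> /andP[v0 v1] kM kc; have v01 : 0 <= v <= 1 by rewrite !ltW.
have M0 : 0 <= M := le_trans (normr_ge0 _) (kM 0).
apply/cvgrPdist_le => e e0.
have e20 : 0 < e / 2 by rewrite divr_gt0.
have /cvgrPdist_le/(_ _ e20) := kc.
rewrite near_nbhs_norm => -[delta /= d0 kd].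
have d20 : 0 < delta ^+ 2 by rewrite exprn_gt0.
pose C := 2 * M / delta ^+ 2.
have C0 : 0 <= C by rewrite divr_ge0 ?mulr_ge0// ltW.
(* Either [i / (n + 1)] is within [delta] of [v], or the quadratic term alone is at least [2 M],
   since [C delta^2 = 2 M]. *)
have bound n i : `|kappa (i%:R / n.+1%:R) - kappa v| <=
    C / n.+1%:R ^+ 2 * (i%:R - n.+1%:R * v) ^+ 2 + e / 2.
  have np : (n.+1%:R : R) != 0 by rewrite pnatr_eq0.
  rewrite (_ : C / _ * _ = C * (i%:R / n.+1%:R - v) ^+ 2); last by field.
  have [close|far] := ltP `|v - i%:R / n.+1%:R| delta.
    rewrite distrC; apply: le_trans (kd _ close) _.
    by rewrite lerDr mulr_ge0// sqr_ge0.
  apply: (@le_trans _ _ (2 * M)).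
    rewrite (le_trans (ler_normB _ _))//; have := kM (i%:R / n.+1%:R); have := kM v; lra.
  apply: ler_wpDr; first exact: ltW.
  rewrite /C [leRHS]mulrAC ler_pdivlMr// ler_wpM2l ?mulr_ge0//.
  rewrite -[leRHS]real_normK ?num_real// distrC.
  by apply: lerXn2r => //; rewrite nnegrE// ltW.
near=> n.
have E1 : (bernstein n.+1 (fun i => kappa (i%:R / n.+1%:R) - kappa v)).[v] =
    (bernstein n.+1 (fun i => kappa (i%:R / n.+1%:R))).[v] - kappa v.
  rewrite -[X in _ - X](bernstein_cst n.+1 (kappa v) v).
  rewrite [RHS]addrC -[X in X + _]mulN1r -bernstein_lin; congr (bernstein _ _).[v].
  by apply/funext => i; rewrite mulN1r addrC.
have E2 : (bernstein n.+1 (fun i => C / n.+1%:R ^+ 2 * (i%:R - n.+1%:R * v) ^+ 2 + e / 2)).[v] =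
    C / n.+1%:R * (v * (1 - v)) + e / 2.
  rewrite bernstein_lin bernstein_cst bernstein_var subrr; field.
  by rewrite ?nat1r pnatr_eq0.
rewrite distrC -E1.
have key : C / n.+1%:R * (v * (1 - v)) + e / 2 <= e.
  suff : C / n.+1%:R * (v * (1 - v)) <= e / 2 by move=> h; rewrite [leRHS]splitr lerD2r.
  apply: (@le_trans _ _ (C / n.+1%:R)).
    by apply: ler_piMr; [rewrite divr_ge0|nra].
  rewrite ler_pdivrMr// -ler_pdivrMl//.
  rewrite (@le_trans _ _ n%:R)//; last by rewrite ler_nat.
  by near: n; exact: nbhs_infty_ger.
apply: le_trans key; rewrite -E2 ler_norml; apply/andP; split; last first.
  by apply: bernstein_le => // i; have := bound n i; rewrite ler_norml => /andP[].
rewrite lerNl -mulN1r -[leLHS]addr0 -[X in _ + X](bernstein_cst n.+1 0 v) -bernstein_lin.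
apply: bernstein_le => // i; have := bound n i.
by rewrite ler_norml mulN1r addr0 => /andP[+ _]; rewrite lerNl.
Unshelve. all: by end_near. Qed.

End bernstein.

Section laplace_independence.
Context {R : realType} d (T : measurableType d) (Q : probability T R).
Variables (S k : T -> R).
Hypotheses (mS : measurable_fun [set: T] S) (S0 : forall w, 0 <= S w).
Hypothesis Spos : {ae Q, forall w, 0 < S w}.
Hypothesis bk : bmfun k.
Hypothesis indep : forall j : nat,
  \int[Q]_w (expR (- (j%:R * S w)) * k w) =
  \int[Q]_w expR (- (j%:R * S w)) * \int[Q]_w k w.

Let V w := expR (- S w).

Let VX j w : V w ^+ j = expR (- (j%:R * S w)).
Proof. by rewrite /V -expRM_natl mulrN. Qed.

Let bmfun_VX j : bmfun (fun w => V w ^+ j).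
Proof.
under eq_fun do rewrite VX.
apply: bmfun_expRN; first exact: measurable_funM.
by move=> w; rewrite mulr_ge0.
Qed.

Let bmfun_poly (p : {poly R}) j : bmfun (fun w => p.[V w] * V w ^+ j).
Proof.
elim/poly_ind: p j => [|p c IHp] j.
  under eq_fun do rewrite horner0 mul0r.
  exact: bmfun_cst.
under eq_fun do rewrite !hornerE mulrDl -mulrA -exprS.
by apply: bmfunD; [exact: IHp|apply: bmfunM; [exact: bmfun_cst|exact: bmfun_VX]].
Qed.

(** A power of [V] is carried along: induction on [p * 'X + c] moves the ['X] into it and leaves the
    monomials, which [indep] covers. *)
Let indep_poly (p : {poly R}) j :
  \int[Q]_w (p.[V w] * V w ^+ j * k w) = \int[Q]_w (p.[V w] * V w ^+ j) * \int[Q]_w k w.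
Proof.
elim/poly_ind: p j => [|p c IHp] j.
  under eq_Rintegral do rewrite horner0 mul0r mul0r.
  under [X in _ = X * _]eq_Rintegral do rewrite horner0 mul0r.
  by rewrite Rintegral_cst1 mul0r.
have bcV : bmfun (fun w => c * V w ^+ j).
  by apply: bmfunM; [exact: bmfun_cst|exact: bmfun_VX].
under eq_Rintegral do rewrite !hornerE mulrDl -mulrA -exprS mulrDl.
under [X in _ = X * _]eq_Rintegral do rewrite !hornerE mulrDl -mulrA -exprS.
rewrite !bmRintegralD//; try by [exact: bmfun_poly|apply: bmfunM => //; exact: bmfun_poly|exact: bmfunM].
rewrite IHp mulrDl; congr (_ + _).
under eq_Rintegral do rewrite -mulrA.
rewrite !bmRintegralZl; try exact: bmfun_VX; try exact: bmfunM (bmfun_VX j) bk.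
rewrite -mulrA; congr (_ * _).
under eq_Rintegral do rewrite VX.
by under [X in _ = X * _]eq_Rintegral do rewrite VX.
Qed.

(** In the variable [V = exp (- S)] the hypothesis [indep] is factorisation for monomials, hence for
    the Bernstein polynomials of [K (- ln V)]. Almost surely [S > 0], so [V] lies in the open unit
    interval, where these converge. *)
Lemma laplace_indep (K : R -> R) : bmfun K ->
  (forall s, 0 < s -> {for s, continuous K}) ->
  \int[Q]_w (K (S w) * k w) = \int[Q]_w K (S w) * \int[Q]_w k w.
Proof.
move=> [mK [M KM]] cK.
have [mk [N kN]] := bk.
pose p n := bernstein n.+1 (fun i => K (- ln (i%:R / n.+1%:R))).
have V01 w : 0 <= V w <= 1.
  by rewrite /V expR_ge0/= -expR0 ler_expR oppr_le0.
have cp : {ae Q, forall w, (p n).[V w] @[n --> \oo] --> K (S w)}.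
  apply: filterS Spos => w Sw.
  have -> : K (S w) = K (- ln (V w)) by rewrite expRK opprK.
  have V0 : 0 < V w := expR_gt0 _.
  apply: (@cvg_bernstein _ (fun v => K (- ln v)) M) => //.
    by rewrite V0/= -expR0 ltr_expR oppr_lt0.
  apply: (@continuous_comp _ _ _ (fun v => - ln v)).
    by apply: cvgN; exact: continuous_ln.
  by apply: cK; rewrite expRK opprK.
have bp n w : `|(p n).[V w]| <= M by exact: bernstein_bound.
have mp n : measurable_fun [set: T] (fun w => (p n).[V w]).
  by have [+ _] := bmfun_poly (p n) 0; under eq_fun do rewrite expr0 mulr1.
have mKS : measurable_fun [set: T] (fun w => K (S w)) by exact: measurableT_comp.
have l1 : \int[Q]_w ((p n).[V w] * k w) @[n --> \oo] --> \int[Q]_w (K (S w) * k w).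
  apply: (@bounded_convergence _ _ _ _ _ _ (M * N)).
  - by move=> n; exact: measurable_funM.
  - exact: measurable_funM.
  - by apply: filterS cp => w cw; apply: cvgM => //; exact: cvg_cst.
  - by move=> n w; rewrite normrM ler_pM.
have l2 : \int[Q]_w (p n).[V w] @[n --> \oo] --> \int[Q]_w K (S w).
  exact: (@bounded_convergence _ _ _ _ _ _ M).
have l3 : \int[Q]_w (p n).[V w] * \int[Q]_w k w @[n --> \oo] -->
    \int[Q]_w K (S w) * \int[Q]_w k w by apply: cvgM => //; exact: cvg_cst.
apply: cvg_unique l1 _ => //.
move: l3; rewrite (_ : (fun n => _) = (fun n => \int[Q]_w ((p n).[V w] * k w)))//.
apply/funext => n; have := indep_poly (p n) 0.
by under eq_Rintegral do rewrite expr0 mulr1; under [X in _ = X * _ -> _]eq_Rintegral do rewrite expr0 mulr1.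
Qed.

End laplace_independence.

(** * Smoothing by Gaussian kernels *)

Section affine_substitution.
Context {R : realType}.
Local Notation mu := (@lebesgue_measure R).

Lemma ge0_integral_affine (G : R -> R) (a b : R) : 0 < a -> continuous G ->
  (forall x, 0 <= G x) ->
  (\int[mu]_x (G x)%:E = \int[mu]_x (G (b + a * x) * a)%:E)%E.
Proof.
move=> a0 cG G0; pose F (x : R^o) : R^o := (x + b / a) * a.
have dF x : is_derive x (1 : R) F a.
  by apply: is_derive_eq; rewrite /GRing.scale/= ; ring.
have F'E : F^`()%classic = cst a.
  by apply/funext => x; rewrite derive1E; have := dF x => -[].
rewrite (@increasing_ge0_integration_by_substitutionT _ F G)//.
- apply: eq_integral => x _; rewrite F'E /= /F; congr (G _ * _)%:E; field.
  by rewrite gt_eqF.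
- by move=> x y xy; rewrite /F ltr_pM2r// ltrD2r.
- by rewrite F'E => ?; exact: cvg_cst.
- by rewrite F'E; exact: is_cvg_cst.
- by rewrite F'E; exact: is_cvg_cst.
- by apply/gt0_cvgMlNy => //; exact: cvg_addrr_Ny.
- by apply/gt0_cvgMly => //; exact: cvg_addrr.
Qed.

End affine_substitution.

Lemma bmfun_Rintegral (R : realType) d1 (T1 : measurableType d1) d2
    (T2 : measurableType d2) (P : probability T2 R) (f : T1 -> T2 -> R) :
  bmfun (fun z : T1 * T2 => f z.1 z.2) -> bmfun (fun x => \int[P]_y f x y).
Proof.
move=> [mf [M fM]].
have bx x : bmfun (f x).
  split; last by exists M => y; exact: (fM (x, y)).
  exact: (measurableT_comp mf (pair1_measurable x)).
split; last first.
  exists M => x; rewrite -[leRHS](Rintegral_cst1 P).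
  by apply: bmRintegral_norm => //; [exact: bmfun_cst|move=> y; exact: (fM (x, y))].
(* Shifting by the bound makes the integrand nonnegative, as measurability of partial integrals in
   Tonelli's theorem requires. *)
pose g (z : T1 * T2) := ((f z.1 z.2 + M)%:E).
have mg : measurable_fun [set: T1 * T2] g.
  by apply/measurable_EFinP; exact: measurable_funD.
have g0 z : (0 <= g z)%E.
  by rewrite lee_fin; have := fM z; rewrite ler_norml => /andP[]; lra.
have := @measurable_fun_fubini_tonelli_F _ _ T1 T2 R P g mg g0.
rewrite /fubini_F /g/= => H.
have E x : (\int[P]_y (f x y + M)%:E)%E = (\int[P]_y f x y + M)%:E.
  rewrite integral_Rintegral; last by apply: bmfunD => //; exact: bmfun_cst.
  by rewrite bmRintegralD ?Rintegral_cst1//; exact: bmfun_cst.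
have {}H : measurable_fun [set: T1] (fun x => (\int[P]_y f x y + M)).
  by apply/measurable_EFinP; apply: eq_measurable_fun H => x _ /=; rewrite E.
have -> : (fun x => \int[P]_y f x y) = (fun x => (\int[P]_y f x y + M) - M).
  by apply/funext => x; rewrite addrK.
exact: measurable_funB.
Qed.

Section gaussian_smoothing.
Context {R : realType} d (T : measurableType d) (Q : probability T R).
Local Notation mu := (@lebesgue_measure R).
Local Notation Phi := (@normal_prob R 0 1).

(** [a] is an inverse standard deviation: the kernel concentrates as [a] grows. *)
Definition gauss_kernel (a y x : R) := expR (- (2^-1 * (a * (x - y)) ^+ 2)).

Variables (X S : T -> R) (h : R -> R -> R) (M : R).
Hypotheses (mX : measurable_fun [set: T] X) (mS : measurable_fun [set: T] S).
Hypotheses (h0 : forall y s, 0 <= h y s) (hM : forall y s, h y s <= M).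
Hypothesis mh : measurable_fun [set: R * R] (fun z => h z.1 z.2).
Hypothesis ch : forall s, continuous (h ^~ s).
Hypothesis dec : forall a y, 0 < a ->
  \int[Q]_w (h y (S w) * gauss_kernel a y (X w)) =
  \int[Q]_w h y (S w) * \int[Q]_w gauss_kernel a y (X w).

Lemma bmfun_hcomp d' (U : measurableType d') (f g : U -> R) :
  measurable_fun [set: U] f -> measurable_fun [set: U] g ->
  bmfun (fun u => h (f u) (g u)).
Proof.
move=> mf mg; split; last by exists M => u; rewrite ger0_norm.
exact: (measurableT_comp mh (measurable_fun_pair mf mg)).
Qed.

Lemma measurable_gauss_kernel a d' (U : measurableType d') (f g : U -> R) :
  measurable_fun [set: U] f -> measurable_fun [set: U] g ->
  measurable_fun [set: U] (fun u => gauss_kernel a (f u) (g u)).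
Proof.
move=> mf mg; apply: measurableT_comp => //; apply: measurableT_comp => //.
apply: measurable_funM => //; apply: measurable_funX.
by apply: measurable_funM => //; exact: measurable_funB.
Qed.

Lemma bmfun_gauss_kernel a d' (U : measurableType d') (f g : U -> R) :
  measurable_fun [set: U] f -> measurable_fun [set: U] g ->
  bmfun (fun u => gauss_kernel a (f u) (g u)).
Proof.
move=> mf mg; apply: bmfun_le1; first exact: measurable_gauss_kernel.
move=> u; rewrite expR_ge0/= -expR0 ler_expR oppr_le0 mulr_ge0//.
exact: sqr_ge0.
Qed.

(** Makes [gauss_kernel a y x * c a] a probability density in [y], that of [x + u / a] with [u]
    standard normal. *)
Let c a : R := a * (Num.sqrt (pi *+ 2))^-1.

Let c_ge0 a : 0 < a -> 0 <= c a.
Proof. by move=> a0; rewrite mulr_ge0 ?invr_ge0// ltW. Qed.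

Lemma integral_kernel_smooth a x s : 0 < a ->
  (\int[mu]_y (h y s * (gauss_kernel a y x * c a))%:E)%E =
  (\int[Phi]_u h (x + a^-1 * u) s)%:E.
Proof.
move=> a0.
have bmh : bmfun (fun u : measurableTypeR R => h (x + a^-1 * u) s).
  apply: bmfun_hcomp; last exact: measurable_cst.
  by apply: measurable_funD => //; exact: measurable_funM.
rewrite -integral_Rintegral// integral_normal_prob//.
rewrite (@ge0_integral_affine _ _ a^-1 x) ?invr_gt0//.
- apply: eq_integral => u _; congr EFin; rewrite normal_pdf01E -!mulrA; congr (_ * _).
  rewrite /gauss_kernel (_ : a * (x - _) = - u); last by field; rewrite gt_eqF.
  by rewrite sqrrN /c; field; rewrite !gt_eqF// sqrt_2pi_gt0.
- move=> y; apply: cvgM; first exact: ch.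
  apply: cvgM; last exact: cvg_cst.
  apply: continuous_comp; last exact: continuous_expR.
  apply: cvgN; apply: cvgM; first exact: cvg_cst.
  apply: (@continuous_comp _ _ _ (fun y => a * (x - y)) (fun z : R => z ^+ 2)); last exact: exprn_continuous.
  apply: cvgM; first exact: cvg_cst.
  by apply: cvgB; [exact: cvg_cst|exact: cvg_id].
- by move=> y; rewrite mulr_ge0// mulr_ge0 ?expR_ge0// c_ge0.
Qed.

Let smooth a x s := \int[Phi]_u h (x + a^-1 * u) s.

Let bmfun_smooth a d' (U : measurableType d') (f g : U -> R) :
  measurable_fun [set: U] f -> measurable_fun [set: U] g ->
  bmfun (fun u => smooth a (f u) (g u)).
Proof.
move=> mf mg; apply: (@bmfun_Rintegral _ _ U _ (measurableTypeR R) Phi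
  (fun u v => h (f u + a^-1 * v) (g u))).
apply: bmfun_hcomp; last exact: measurableT_comp mg measurable_fst.
apply: measurable_funD; first exact: measurableT_comp mf measurable_fst.
by apply: measurable_funM => //; exact: measurable_sndR.
Qed.

Let smooth_le a x s : `|smooth a x s| <= M.
Proof.
rewrite -[leRHS](Rintegral_cst1 Phi); apply: bmRintegral_norm.
- apply: bmfun_hcomp; last exact: measurable_cst.
  by apply: measurable_funD => //; exact: measurable_funM.
- exact: bmfun_cst.
- by move=> u; rewrite ger0_norm.
Qed.

Let cvg_smooth x s : smooth n.+1%:R x s @[n --> \oo] --> h x s.
Proof.
rewrite -[X in _ --> X](Rintegral_cst1 Phi).
apply: (@bounded_convergence _ _ _ _ _ _ M).
- move=> n; have [] := @bmfun_hcomp _ (measurableTypeR R) (fun u => x + n.+1%:R^-1 * u) (fun=> s); last by [].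
  + by apply: measurable_funD => //; exact: measurable_funM.
  + exact: measurable_cst.
- exact: measurable_cst.
- apply: aeW => u.
  have cu : (x + n.+1%:R^-1 * u) @[n --> \oo] --> x + 0 * u.
    apply: cvgD; first exact: cvg_cst.
    by apply: cvgM; [exact: cvg_harmonic|exact: cvg_cst].
  rewrite mul0r addr0 in cu.
  by apply: (cvg_comp _ (h ^~ s) cu); exact: ch.
- by move=> n u; rewrite ger0_norm.
Qed.

(** Smoothing is a Lebesgue integral over the centre [y]. Integrating over [y] last leaves, for
    fixed [y], a function of [S] times a kernel in [X], to which [dec] applies; both sides reduce to
    the same integral over [y]. *)
Let smooth_dec a : 0 < a ->
  \int[Q]_w smooth a (X w) (S w) = \int[Q]_w' \int[Q]_w smooth a (X w') (S w).
Proof.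
move=> a0.
have mfst1 : measurable_fun [set: measurableTypeR R * T] (fun z => z.1 : R).
  exact: measurable_fst.
have mSs : measurable_fun [set: measurableTypeR R * T] (fun z => S z.2).
  exact: measurableT_comp mS measurable_snd.
have mXs : measurable_fun [set: measurableTypeR R * T] (fun z => X z.2).
  exact: measurableT_comp mX measurable_snd.
pose D y x := gauss_kernel a y x * c a.
have D0 y x : 0 <= D y x by rewrite mulr_ge0 ?expR_ge0// c_ge0.
have bD y : bmfun (fun w => D y (X w)).
  by apply: bmfunM; [exact: bmfun_gauss_kernel|exact: bmfun_cst].
have bh y : bmfun (fun w => h y (S w)) by exact: bmfun_hcomp.
have bH : bmfun (fun y : measurableTypeR R => \int[Q]_w h y (S w)).
  apply: (@bmfun_Rintegral _ _ (measurableTypeR R) _ T Q (fun y w => h y (S w))).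
  exact: bmfun_hcomp.
have H0 y : 0 <= \int[Q]_w h y (S w) by apply: Rintegral_ge0.
have dec' y : \int[Q]_w (h y (S w) * D y (X w)) = \int[Q]_w h y (S w) * \int[Q]_w D y (X w).
  rewrite /D bmRintegralZr; last exact: bmfun_gauss_kernel.
  under eq_Rintegral do rewrite mulrA.
  rewrite bmRintegralZr; last by apply: bmfunM => //; exact: bmfun_gauss_kernel.
  by rewrite dec// mulrA.
have lhs : (\int[Q]_w (smooth a (X w) (S w))%:E =
    \int[mu]_y (\int[Q]_w h y (S w) * \int[Q]_w D y (X w))%:E)%E.
  under eq_integral do rewrite -integral_kernel_smooth//.
  rewrite -(@fubini_tonelli _ _ (measurableTypeR R) T R mu Q
    (fun z => (h z.1 (S z.2) * D z.1 (X z.2))%:E)); last 2 first.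
  - apply/measurable_EFinP; apply: measurable_funM; first exact: (bmfun_hcomp _ _).1.
    by apply: measurable_funM => //; exact: measurable_gauss_kernel.
  - by move=> z; rewrite lee_fin mulr_ge0.
  apply: eq_integral => y _ /=.
  by rewrite integral_Rintegral ?dec'//; exact: bmfunM.
have rhs : (\int[Q]_w' (\int[Q]_w smooth a (X w') (S w))%:E =
    \int[mu]_y (\int[Q]_w h y (S w) * \int[Q]_w D y (X w))%:E)%E.
  transitivity (\int[Q]_w' \int[mu]_y ((\int[Q]_w h y (S w)) * D y (X w'))%:E)%E.
    apply: eq_integral => w' _.
    rewrite -integral_Rintegral; last exact: bmfun_smooth.
    under eq_integral do rewrite -integral_kernel_smooth//.
    rewrite -(@fubini_tonelli _ _ (measurableTypeR R) T R mu Q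
      (fun z => (h z.1 (S z.2) * D z.1 (X w'))%:E)); last 2 first.
    - apply/measurable_EFinP; apply: measurable_funM; first exact: (bmfun_hcomp _ _).1.
      by apply: measurable_funM => //; exact: measurable_gauss_kernel.
    - by move=> z; rewrite lee_fin mulr_ge0.
    apply: eq_integral => y _ /=.
    rewrite integral_Rintegral; last by apply: bmfunM => //; exact: bmfun_cst.
    by rewrite bmRintegralZr.
  rewrite -(@fubini_tonelli _ _ (measurableTypeR R) T R mu Q
    (fun z => ((\int[Q]_w h z.1 (S w)) * D z.1 (X z.2))%:E)); last 2 first.
  - apply/measurable_EFinP; apply: measurable_funM.
      by have [mH _] := bH; exact: measurableT_comp mH measurable_fst.
    by apply: measurable_funM => //; exact: measurable_gauss_kernel.
  - by move=> z; rewrite lee_fin mulr_ge0.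
  apply: eq_integral => y _ /=.
  rewrite integral_Rintegral; last by apply: bmfunM => //; exact: bmfun_cst.
  by rewrite bmRintegralZl.
by rewrite /Rintegral; congr fine; rewrite lhs -rhs.
Qed.

(** Separate sample points [w'] and [w] express integration against the product of the laws of [X]
    and [S]. The smoothed identity passes to the limit by bounded convergence as the kernels
    concentrate. *)
Lemma gauss_kernel_decouple :
  \int[Q]_w h (X w) (S w) = \int[Q]_w' \int[Q]_w h (X w') (S w).
Proof.
have l1 : \int[Q]_w smooth n.+1%:R (X w) (S w) @[n --> \oo] --> \int[Q]_w h (X w) (S w).
  apply: (@bounded_convergence _ _ _ _ _ _ M) => //.
  - by move=> n; exact: (bmfun_smooth _ _ _).1.
  - exact: (bmfun_hcomp _ _).1.
  - by apply: aeW => w; exact: cvg_smooth.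
have mXf : measurable_fun [set: T * T] (fun z => X z.1).
  exact: measurableT_comp mX measurable_fst.
have mSs : measurable_fun [set: T * T] (fun z => S z.2).
  exact: measurableT_comp mS measurable_snd.
have l2 : \int[Q]_w' \int[Q]_w smooth n.+1%:R (X w') (S w) @[n --> \oo] -->
    \int[Q]_w' \int[Q]_w h (X w') (S w).
  apply: (@bounded_convergence _ _ _ _ _ _ M) => //.
  - move=> n; apply: (@bmfun_Rintegral _ _ T _ T Q (fun w' w => smooth n.+1%:R (X w') (S w)) _).1.
    exact: bmfun_smooth.
  - apply: (@bmfun_Rintegral _ _ T _ T Q (fun w' w => h (X w') (S w)) _).1.
    exact: bmfun_hcomp.
  - apply: aeW => w'; apply: (@bounded_convergence _ _ _ _ _ _ M) => //.
    + by move=> n; exact: (bmfun_smooth _ _ _).1.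
    + exact: (bmfun_hcomp _ _).1.
    + by apply: aeW => w; exact: cvg_smooth.
  - move=> n w; rewrite -[leRHS](Rintegral_cst1 Q); apply: bmRintegral_norm => //.
    + exact: bmfun_smooth.
    + exact: bmfun_cst.
apply: cvg_unique l1 _ => //.
by move: l2; under eq_fun do rewrite -smooth_dec//.
Qed.

End gaussian_smoothing.

(** * The law of the Student ratio *)

Section gaussian_sqsum_moment.
Context {R : realType} d (T : measurableType d) (Q : probability T R) (q : nat).
Variables (X : T -> R) (W : 'I_q -> T -> R).
Hypothesis gaussXW : forall (a0 : R) (c : 'I_q -> R),
  normal0_rv Q (fun w => a0 * X w + \sum_(l < q) c l * W l w)
    (a0 ^+ 2 + \sum_(l < q) c l ^+ 2).
Local Notation S := (gauss_sqsum W q).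

Lemma expR_id_le1 (u : R) : u * expR (- u) <= 1.
Proof.
rewrite expRN ler_pdivrMr ?expR_gt0// mul1r.
by apply: le_trans (expR_ge1Dx _); rewrite lerDr.
Qed.

Lemma gauss_laplace_powR b : 0 <= b ->
  \int[Q]_w expR (- (b * S w)) = powR (1 + 2 * b) (- (q%:R / 2)).
Proof.
move=> b0; have b20 : 0 < 1 + 2 * b by rewrite ltr_pwDl// mulr_ge0.
rewrite (gauss_laplace gaussXW b0) sqrtrV; last exact: ltW.
by rewrite exprVn -powR12_sqrt ?ltW// -powR_mulrn ?powR_ge0// -powRrM powRN [2^-1 * _]mulrC.
Qed.

Lemma bmfun_sqsum_expR b : 0 < b -> bmfun (fun w => S w * expR (- (b * S w))).
Proof.
move=> b0; split.
  apply: measurable_funM; first exact: (measurable_gauss_sqsum gaussXW).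
  exact: (bmfun_expR_sqsum gaussXW q (ltW b0)).1.
exists b^-1 => w; rewrite ger0_norm ?mulr_ge0 ?expR_ge0 ?gauss_sqsum_ge0//.
rewrite -(ler_pM2l b0) mulrA divff ?gt_eqF//.
exact: expR_id_le1.
Qed.

(** Differentiates the Laplace transform at [b = y^2]. The square makes the transform formula an
    identity of functions on the whole line, so both sides can be differentiated in [y]. *)
Lemma gauss_sqsum_laplace x : 0 < x ->
  \int[Q]_w (S w * expR (- (x ^+ 2 * S w))) =
  q%:R * powR (1 + 2 * x ^+ 2) (- (q%:R / 2) - 1).
Proof.
move=> x0.
pose f y w : R := expR (- (y ^+ 2 * S w)).
have df y w : is_derive y (1 : R) (f ^~ w) (- (2 * y * (S w * f y w))).
  by apply: is_derive_eq; rewrite /GRing.scale/= /f; ring.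
have d1f y w : partial1of2 f y w = - (2 * y * (S w * f y w)).
  by rewrite partial1of2E; have := df y w => -[].
have Ix : `]x / 2, 2 * x[%classic x by rewrite /= in_itv/=; apply/andP; split; lra.
have intf y : `]x / 2, 2 * x[%classic y -> Q.-integrable [set: T] (EFin \o f y).
  by move=> _; apply: bmfun_integrable; apply: (bmfun_expR_sqsum gaussXW); exact: sqr_ge0.
have derf y w : `]x / 2, 2 * x[%classic y -> [set: T] w -> derivable (f ^~ w) y 1.
  by move=> _ _; have := df y w => -[].
(* For [x / 2 < y < 2 x], the factor [2 y] is at most [4 x] and [S exp (- y^2 S)] is at most
   [4 / x^2]. *)
pose G (w : T) : R := 16 / x.
have G0 w : 0 <= G w by rewrite divr_ge0// ltW.
have intG : Q.-integrable [set: T] (EFin \o G).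
  by apply: bmfun_integrable; exact: bmfun_cst.
have Gub y w : `]x / 2, 2 * x[%classic y -> [set: T] w -> `|partial1of2 f y w| <= G w.
  rewrite /= in_itv/= => /andP[y1 y2] _.
  have y0 : 0 < y by lra.
  have Sw := gauss_sqsum_ge0 W q w.
  rewrite d1f normrN ger0_norm; last first.
    by rewrite mulr_ge0 ?mulr_ge0 ?expR_ge0// ltW.
  have h1 : f y w <= expR (- (x ^+ 2 / 4 * S w)).
    rewrite ler_expR lerN2 ler_wpM2r//.
    rewrite (_ : x ^+ 2 / 4 = (x / 2) ^+ 2); last by field.
    by apply: lerXn2r; rewrite ?nnegrE; lra.
  have h2 : S w * f y w <= 4 / x ^+ 2.
    apply: (@le_trans _ _ (S w * expR (- (x ^+ 2 / 4 * S w)))); first exact: ler_wpM2l.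
    have c0 : 0 < x ^+ 2 / 4 by rewrite divr_gt0// exprn_gt0.
    rewrite -(ler_pM2l c0) mulrA (le_trans (expR_id_le1 _))//.
    by rewrite (_ : _ * _ = 1)//; field; rewrite gt_eqF.
  apply: (@le_trans _ _ (4 * x * (4 / x ^+ 2))); last first.
    by rewrite /G (_ : 4 * x * _ = 16 / x)//; field; rewrite gt_eqF.
  by apply: ler_pM => //; [lra|rewrite mulr_ge0// expR_ge0|lra].
have := differentiation_under_integral measurableT Ix intf derf G0 intG Gub.
have -> : (fun y => \int[Q]_w f y w) = (fun y => powR (1 + 2 * y ^+ 2) (- (q%:R / 2))).
  by apply/funext => y; rewrite /f gauss_laplace_powR// sqr_ge0.
have p0 : 0 < 1 + 2 * x ^+ 2 by rewrite ltr_pwDl// mulr_ge0// sqr_ge0.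
have dp : is_derive x (1 : R) (fun y : R => powR (1 + 2 * y ^+ 2) (- (q%:R / 2)))
    (4 * x * (- (q%:R / 2) * powR (1 + 2 * x ^+ 2) (- (q%:R / 2) - 1))).
  have d1 := is_derive1_powR (- (q%:R / 2)) p0.
  have d2 : is_derive x (1 : R) (fun y : R => 1 + 2 * y ^+ 2) (4 * x).
    by apply: is_derive_eq; rewrite /GRing.scale/=; ring.
  have d3 := @is_derive1_comp _ (fun z : R => powR z (- (q%:R / 2))) (fun y : R => 1 + 2 * y ^+ 2) x _ _ d1 d2.
  by apply: (is_derive_eq d3); rewrite [RHS]mulrC.
rewrite derive1E (@derive_val _ _ _ _ _ _ _ dp).
under eq_Rintegral do rewrite d1f -mulNr.
rewrite bmRintegralZl; last by apply: bmfun_sqsum_expR; rewrite exprn_gt0.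
move=> e.
apply: (@mulfI _ (- (2 * x))); first by rewrite oppr_eq0 mulf_eq0 pnatr_eq0/= gt_eqF.
by rewrite -e; field.
Qed.

End gaussian_sqsum_moment.

Lemma continuous_powR_pos (R : realType) (a x : R) : 0 < x -> {for x, continuous (fun z : R => powR z a)}.
Proof.
move=> x0; apply: differentiable_continuous; apply/derivable1_diffP.
by have := is_derive1_powR a x0 => -[].
Qed.

Lemma continuous_powR_1Dsqr (R : realType) (b c e : R) : 0 < b -> 0 <= c ->
  continuous (fun n : R => powR (b + c * n ^+ 2) e).
Proof.
move=> b0 c0 n; apply: (@continuous_comp _ _ _ (fun n : R => b + c * n ^+ 2) (fun z : R => powR z e)).
  apply: cvgD; first exact: cvg_cst.
  by apply: cvgM; [exact: cvg_cst|exact: exprn_continuous].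
by apply: continuous_powR_pos; rewrite ltr_pwDl// mulr_ge0// sqr_ge0.
Qed.

Section student_density.
Context {R : realType} d (T : measurableType d) (Q : probability T R) (q : nat).
Local Notation mu := (@lebesgue_measure R).
Local Notation Phi := (@normal_prob R 0 1).
Variables (X : T -> R) (W : 'I_q -> T -> R).
Hypothesis gaussXW : forall (a0 : R) (c : 'I_q -> R),
  normal0_rv Q (fun w => a0 * X w + \sum_(l < q) c l * W l w)
    (a0 ^+ 2 + \sum_(l < q) c l ^+ 2).
Hypothesis q_gt0 : (0 < q)%N.
Local Notation S := (gauss_sqsum W q).

Let qR_gt0 : 0 < q%:R :> R. Proof. by rewrite ltr0n. Qed.
Let qR_neq0 : q%:R != 0 :> R. Proof. by rewrite gt_eqF. Qed.
Let S_ge0 w : 0 <= S w. Proof. exact: gauss_sqsum_ge0. Qed.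
Let mX : measurable_fun [set: T] X. Proof. exact: (measurable_gaussX gaussXW). Qed.
Let mS : measurable_fun [set: T] S. Proof. exact: (measurable_gauss_sqsum gaussXW). Qed.

(** [S = 0] forces the first coordinate of [W] to vanish, and a standard normal law has no atom at
    0. *)
Lemma gauss_sqsum_gt0_ae : {ae Q, forall w, 0 < S w}.
Proof.
have [mW lW] := normal0_gaussW gaussXW (Ordinal q_gt0).
exists (W (Ordinal q_gt0) @^-1` [set 0]); split.
- by rewrite -[X in measurable X]setTI; apply: mW => //; exact: measurable_set1.
- rewrite lW; last exact: measurable_set1.
  by rewrite ltr01 sqrtr1 /normal_prob integral_set1.
- move=> w /= /negP; rewrite lt_neqAle S_ge0 andbT negbK eq_sym /gauss_sqsum.
  rewrite psumr_eq0; last by move=> l _; exact: sqr_ge0.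
  move=> /allP/(_ (Ordinal q_gt0) (mem_index_enum _))/=.
  by rewrite q_gt0/= sqrf_eq0 => /eqP.
Qed.

Let r w := powR (S w / q%:R) 2^-1.

Let r_ge0 w : 0 <= r w. Proof. exact: powR_ge0. Qed.

Let r2 w : r w ^+ 2 = S w / q%:R.
Proof.
have Sq0 : 0 <= S w / q%:R by rewrite divr_ge0// ltW.
by rewrite /r powR12_sqrt// sqr_sqrtr.
Qed.

Let mr : measurable_fun [set: T] r.
Proof.
apply: (measurableT_comp (measurable_powR 2^-1)).
exact: measurable_funM.
Qed.

(** The factor of [t_kernel] in the density of the ratio. It is extended-real because its
    finiteness, like its value, is deduced only later from total mass 1. *)
Definition student_mass : \bar R :=
  ((2 * pi)^-1%:E * \int[mu]_m (powR (1 + q%:R^-1 * m ^+ 2) (- (q%:R / 2) - 1))%:E)%E.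

(** Given [S], the ratio has density [r * normal_pdf 0 1 (r * x)]. Multiplying by the integral over
    [n] of the same expression at [n] turns [r] into [r^2 = S / q], and Tonelli leaves
    [E S exp (- y^2 S)]. The condition [x != 0] keeps [y > 0] even at [n = 0]. *)
Lemma student_density x : x != 0 ->
  (\int[Q]_w (r w * normal_pdf 0 1 (r w * x))%:E = (t_kernel q x)%:E * student_mass)%E.
Proof.
move=> x0; have x20 : 0 < x ^+ 2 by rewrite exprn_even_gt0.
have pi0 : 0 < (2 * pi)^-1 :> R by rewrite invr_gt0 mulr_gt0// pi_gt0.
pose g w n : R := (2 * pi)^-1 * (r w ^+ 2 * expR (- (2^-1 * r w ^+ 2 * (x ^+ 2 + n ^+ 2)))).
have g0 w n : 0 <= g w n by rewrite !mulr_ge0 ?expR_ge0 ?sqr_ge0// ltW.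
have mix w : (r w * normal_pdf 0 1 (r w * x))%:E = (\int[mu]_n (g w n)%:E)%E.
  have [rw0|rw0] := eqVneq (r w) 0.
    rewrite rw0 mul0r; under eq_integral do rewrite /g rw0 expr0n mul0r mulr0.
    by rewrite integral0.
  have rw : 0 < r w by rewrite lt_neqAle eq_sym rw0 r_ge0.
  have rw2 : 0 < 2^-1 * r w ^+ 2 by rewrite mulr_gt0// exprn_gt0.
  transitivity (\int[mu]_n (((2 * pi)^-1 * r w ^+ 2 * expR (- (2^-1 * (r w * x) ^+ 2)))%:E
      * (expR (- (2^-1 * r w ^+ 2 * n ^+ 2)))%:E))%E; last first.
    apply: eq_integral => n _; rewrite -EFinM /g; congr EFin.
    rewrite (_ : expR (- (2^-1 * r w ^+ 2 * (x ^+ 2 + n ^+ 2))) =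
      expR (- (2^-1 * (r w * x) ^+ 2)) * expR (- (2^-1 * r w ^+ 2 * n ^+ 2))); last first.
      by rewrite -expRD; congr expR; ring.
    by rewrite !mulrA.
  rewrite ge0_integralZl//=; last 2 first.
  - by apply/measurable_EFinP; exact: measurable_expR_sqr.
  - by rewrite lee_fin !mulr_ge0 ?expR_ge0// ltW.
  rewrite integral_expR_sqr// -EFinM normal_pdf01E; congr EFin.
  have -> : Num.sqrt (pi / (2^-1 * r w ^+ 2)) = Num.sqrt (pi *+ 2) / r w.
    rewrite (_ : pi / _ = (pi *+ 2) * (r w)^-1 ^+ 2); last first.
      by rewrite -mulr_natr; move: (pi : R) => p; field.
    have pi20 : 0 <= pi *+ 2 :> R by rewrite mulrn_wge0// pi_ge0.
    by rewrite (sqrtrM _ pi20) sqrtr_sqr ger0_norm// invr_ge0.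
  have := @sqrt_2pi_gt0 R; set s := Num.sqrt _ => s0.
  have -> : 2 * pi = s ^+ 2 by rewrite sqr_sqrtr ?mulr_natl// mulrn_wge0// pi_ge0.
  by field; rewrite rw0 gt_eqF.
under eq_integral do rewrite mix.
rewrite (@fubini_tonelli _ _ T (measurableTypeR R) R Q mu (fun z => (g z.1 z.2)%:E)); last 2 first.
- apply/measurable_EFinP; rewrite /g.
  have mr2 : measurable_fun [set: T * measurableTypeR R] (fun z => r z.1 ^+ 2).
    by apply: measurable_funX; exact: measurableT_comp mr measurable_fst.
  apply: measurable_funM => //; apply: measurable_funM => //.
  apply: measurableT_comp => //; apply: measurableT_comp => //.
  apply: measurable_funM; first exact: measurable_funM.
  by apply: measurable_funD => //; apply: measurable_funX; exact: measurable_sndR.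
- by move=> z; rewrite lee_fin.
have inner n : (\int[Q]_w (g w n)%:E)%E =
    ((2 * pi)^-1 * powR (1 + q%:R^-1 * x ^+ 2 + q%:R^-1 * n ^+ 2) (- (q%:R / 2) - 1))%:E.
  pose y := Num.sqrt ((x ^+ 2 + n ^+ 2) / (2 * q%:R)).
  have y0' : 0 < (x ^+ 2 + n ^+ 2) / (2 * q%:R).
    by rewrite divr_gt0 ?mulr_gt0// ltr_pwDl// sqr_ge0.
  have y0 : 0 < y by rewrite sqrtr_gt0.
  have y2 : y ^+ 2 = (x ^+ 2 + n ^+ 2) / (2 * q%:R) by rewrite sqr_sqrtr// ltW.
  transitivity (\int[Q]_w ((2 * pi)^-1 / q%:R * (S w * expR (- (y ^+ 2 * S w))))%:E)%E.
    apply: eq_integral => w _; congr EFin; rewrite /g r2 y2.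
    rewrite (_ : 2^-1 * (S w / q%:R) * (x ^+ 2 + n ^+ 2) = (x ^+ 2 + n ^+ 2) / (2 * q%:R) * S w); last by field.
    by move: ((2 * pi)^-1 : R) => p; field.
  have bS := bmfun_sqsum_expR gaussXW (exprn_gt0 2 y0).
  rewrite integral_Rintegral; last by apply: bmfunM => //; exact: bmfun_cst.
  rewrite bmRintegralZl// (gauss_sqsum_laplace gaussXW y0); congr EFin.
  rewrite (_ : 1 + 2 * y ^+ 2 = 1 + q%:R^-1 * x ^+ 2 + q%:R^-1 * n ^+ 2); last by rewrite y2; field.
  by rewrite mulrA divfK.
under eq_integral do rewrite /= inner EFinM.
pose A := 1 + q%:R^-1 * x ^+ 2.
have qi0 : 0 <= q%:R^-1 :> R by rewrite invr_ge0 ltW.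
have A0 : 0 < A by rewrite /A ltr_pwDl// mulr_ge0// ltW.
pose e : R := - (q%:R / 2) - 1.
pose B (m : R) := 1 + q%:R^-1 * m ^+ 2.
have B0 m : 0 < B m by rewrite /B ltr_pwDl// mulr_ge0// sqr_ge0.
have mpow c : 0 < c -> measurable_fun [set: measurableTypeR R] (fun n : R => (powR (c + q%:R^-1 * n ^+ 2) e)%:E).
  move=> c0; apply/measurable_EFinP; apply: continuous_measurable_fun.
  exact: continuous_powR_1Dsqr.
rewrite ge0_integralZl//; last 3 first.
- exact: mpow.
- by move=> n _; rewrite lee_fin powR_ge0.
- by rewrite lee_fin ltW.
rewrite /student_mass muleCA; congr (_ * _)%E.
(* With [n = A^(1/2) m], the sum [A + n^2 / q] factors as [A] times [B m], and the Jacobian raises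
   the exponent of [A] from [- q / 2 - 1] to the Student exponent [- (q + 1) / 2]. *)
rewrite (@ge0_integral_affine _ _ (powR A 2^-1) 0); last 3 first.
- exact: powR_gt0.
- exact: continuous_powR_1Dsqr.
- by move=> n; exact: powR_ge0.
transitivity (\int[mu]_m ((t_kernel q x)%:E * (powR (B m) e)%:E))%E; last first.
  rewrite ge0_integralZl//; first exact: mpow.
  - by move=> n _; rewrite lee_fin powR_ge0.
  - by rewrite lee_fin powR_ge0.
apply: eq_integral => m _; rewrite -EFinM; congr EFin.
have A2 : powR A 2^-1 ^+ 2 = A by rewrite powR12_sqrt ?ltW// sqr_sqrtr// ltW.
rewrite add0r exprMn A2 -/A (_ : A + _ = A * B m); last by rewrite /B; ring.
rewrite powRM ?ltW// -/(B m) -/e mulrAC; congr (_ * _).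
rewrite -powRD; last by apply/implyP => _; rewrite gt_eqF.
rewrite /t_kernel /A [x ^+ 2 / _]mulrC; congr powR.
by rewrite /e; field.
Qed.

End student_density.

Section student_law.
Context {R : realType} d (T : measurableType d) (Q : probability T R) (q : nat).
Local Notation mu := (@lebesgue_measure R).
Local Notation Phi := (@normal_prob R 0 1).
Variables (X : T -> R) (W : 'I_q -> T -> R).
Hypothesis gaussXW : forall (a0 : R) (c : 'I_q -> R),
  normal0_rv Q (fun w => a0 * X w + \sum_(l < q) c l * W l w)
    (a0 ^+ 2 + \sum_(l < q) c l ^+ 2).
Hypothesis q_gt0 : (0 < q)%N.
Local Notation S := (gauss_sqsum W q).

Let qR_gt0 : 0 < q%:R :> R. Proof. by rewrite ltr0n. Qed.
Let S_ge0 w : 0 <= S w. Proof. exact: gauss_sqsum_ge0. Qed.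
Let mX : measurable_fun [set: T] X. Proof. exact: (measurable_gaussX gaussXW). Qed.
Let mS : measurable_fun [set: T] S. Proof. exact: (measurable_gauss_sqsum gaussXW). Qed.

Let r w := powR (S w / q%:R) 2^-1.

Let mr : measurable_fun [set: T] r.
Proof.
apply: (measurableT_comp (measurable_powR 2^-1)).
exact: measurable_funM.
Qed.

Lemma t_kernel_gt0 (x : R) : 0 < t_kernel q x.
Proof. by rewrite powR_gt0// ltr_pwDl// mulr_ge0 ?sqr_ge0// invr_ge0 ltW. Qed.

Lemma measurable_t_kernel : measurable_fun [set: R] (@t_kernel R q).
Proof.
have -> : @t_kernel R q = fun x => powR (1 + q%:R^-1 * x ^+ 2) (- ((q%:R + 1) / 2)).
  by apply/funext => x; rewrite /t_kernel [x ^+ 2 / _]mulrC.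
apply: continuous_measurable_fun; apply: continuous_powR_1Dsqr => //.
Qed.

Lemma student_mass_ge0 : (0 <= @student_mass R q)%E.
Proof.
rewrite /student_mass mule_ge0//.
  by rewrite lee_fin invr_ge0 mulr_ge0// pi_ge0.
by apply: integral_ge0 => x _; rewrite lee_fin powR_ge0.
Qed.

(** Nonnegativity of [f] permits Tonelli while [student_mass] is not yet known to be finite. *)
Lemma student_law_ge0 (f : R -> R) (M : R) : continuous f ->
  (forall x, 0 <= f x) -> (forall x, f x <= M) ->
  (\int[Q]_w (f (X w * powR (S w / q%:R) (- 2^-1)))%:E =
   \int[mu]_x ((f x)%:E * ((t_kernel q x)%:E * student_mass q)))%E.
Proof.
move=> cf f0 fM.
pose h y s := f (y * powR (s / q%:R) (- 2^-1)).
have hM y s : `|h y s| <= M by rewrite /h ger0_norm.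
have mf : measurable_fun [set: R] f by exact: continuous_measurable_fun.
have mh : measurable_fun [set: R * R] (fun z => h z.1 z.2).
  apply: (measurableT_comp mf); apply: measurable_funM; first exact: measurable_fst.
  apply: (measurableT_comp (measurable_powR _)).
  by apply: measurable_funM => //; exact: measurable_snd.
have ch s : continuous (h ^~ s).
  move=> y; apply: continuous_comp; last exact: cf.
  by apply: cvgM; [exact: cvg_id|exact: cvg_cst].
have bh y : bmfun (h y).
  split; last by exists M => s; exact: hM.
  exact: (measurableT_comp mh (pair1_measurable y)).
have dec a y : 0 < a ->
    \int[Q]_w (h y (S w) * gauss_kernel a y (X w)) =
    \int[Q]_w h y (S w) * \int[Q]_w gauss_kernel a y (X w).
  move=> a0; apply: laplace_indep => //.
  - exact: (gauss_sqsum_gt0_ae gaussXW q_gt0).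
  - exact: bmfun_gauss_kernel.
  - by move=> j; apply: (gauss_laplace_kernel gaussXW).
  - move=> s s0; apply: continuous_comp; last exact: cf.
    apply: cvgM; first exact: cvg_cst.
    apply: (@continuous_comp _ _ _ (fun t : R => t / q%:R) (fun z : R => powR z (- 2^-1))).
      by apply: cvgM; [exact: cvg_id|exact: cvg_cst].
    by apply: continuous_powR_pos; rewrite divr_gt0.
have bhS : bmfun (fun w => h (X w) (S w)).
  split; last by exists M => w; exact: hM.
  exact: (measurableT_comp mh (measurable_fun_pair mX mS)).
have bhP : bmfun (fun z : T * measurableTypeR R => h z.2 (S z.1)).
  split; last by exists M => z; exact: hM.
  have mS1 : measurable_fun [set: T * measurableTypeR R] (fun z => S z.1).
    exact: measurableT_comp mS measurable_fst.
  exact: (measurableT_comp mh (measurable_fun_pair (@measurable_sndR R _ T) mS1)).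
(* Decoupling lets [X] be replaced by a standard normal [n] independent of [S]. *)
have step1 : \int[Q]_w h (X w) (S w) = \int[Q]_w \int[Phi]_n h n (S w).
  rewrite (@gauss_kernel_decouple _ _ _ Q X S h M mX mS (fun y s => f0 _) (fun y s => fM _) mh ch dec).
  rewrite bmRintegral_Fubini; last first.
    split; last by exists M => z; exact: hM.
    have mX1 : measurable_fun [set: T * T] (fun z => X z.1).
      exact: measurableT_comp mX measurable_fst.
    have mS2 : measurable_fun [set: T * T] (fun z => S z.2).
      exact: measurableT_comp mS measurable_snd.
    exact: (measurableT_comp mh (measurable_fun_pair mX1 mS2)).
  apply: eq_Rintegral => w _.
  apply: (normal0_rv_Rintegral (normal0_gaussX gaussXW) (f := h ^~ (S w))).
  split; last by exists M => s; exact: hM.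
  exact: (measurableT_comp mh (pair2_measurable (S w))).
pose g w x : R := f x * (r w * normal_pdf 0 1 (r w * x)).
have g0 w x : 0 <= g w x by rewrite mulr_ge0// mulr_ge0 ?powR_ge0 ?normal_pdf_ge0.
have mg : measurable_fun [set: T * measurableTypeR R] (fun z => (g z.1 z.2)%:E).
  have mr1 : measurable_fun [set: T * measurableTypeR R] (fun z => r z.1).
    exact: measurableT_comp mr measurable_fst.
  have m2 := @measurable_sndR R _ T.
  apply/measurable_EFinP; apply: measurable_funM; first exact: measurableT_comp mf m2.
  apply: measurable_funM => //.
  apply: (measurableT_comp (@measurable_normal_pdf R 0 1)).
  exact: measurable_funM.
(* For fixed [S > 0], the substitution [n = r x] turns the ratio into [x]. *)
have step2 : (\int[Q]_w (\int[Phi]_n h n (S w))%:E = \int[Q]_w \int[mu]_x (g w x)%:E)%E.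
  apply: ae_eq_integral => //.
  - apply/measurable_EFinP.
    exact: (@bmfun_Rintegral _ _ T _ (measurableTypeR R) Phi (fun w n => h n (S w)) bhP).1.
  - exact: (@measurable_fun_fubini_tonelli_F _ _ T (measurableTypeR R) R mu _ mg (fun z => g0 _ _)).
  - apply: filterS (gauss_sqsum_gt0_ae gaussXW q_gt0) => w Sw _.
    have Sq : 0 < S w / q%:R by rewrite divr_gt0.
    have rw : 0 < r w by rewrite powR_gt0.
    have bhw : bmfun (fun n : measurableTypeR R => h n (S w)).
      split; last by exists M => s; exact: hM.
      exact: (measurableT_comp mh (pair2_measurable (S w))).
    rewrite -integral_Rintegral// integral_normal_prob//.
    rewrite [LHS](@ge0_integral_affine _ (fun x => h x (S w) * normal_pdf 0 1 x) (r w) 0)//; last 2 first.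
    + move=> x; apply: cvgM; first exact: ch.
      by apply: continuous_normal_pdf; rewrite oner_eq0.
    + by move=> x; apply: mulr_ge0; [exact: f0|exact: normal_pdf_ge0].
    apply: eq_integral => x _; congr EFin; rewrite /g /h add0r powRN -/(r w).
    rewrite (_ : r w * x / r w = x); last by field; rewrite gt_eqF.
    by rewrite -mulrA [_ * r w]mulrC.
transitivity ((\int[Q]_w h (X w) (S w))%:E).
  exact: (@integral_Rintegral _ T R Q (fun w => h (X w) (S w))).
rewrite step1 -integral_Rintegral; last first.
  exact: (@bmfun_Rintegral _ _ T _ (measurableTypeR R) Phi (fun w n => h n (S w)) bhP).
rewrite step2 (fubini_tonelli _ mg); last by move=> z; rewrite lee_fin.
apply: ae_eq_integral => //.
- exact: (@measurable_fun_fubini_tonelli_G _ _ T (measurableTypeR R) R Q _ mg (fun z => g0 _ _)).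
- apply: emeasurable_funM; first exact/measurable_EFinP.
  apply: emeasurable_funM; last exact: measurable_cst.
  by apply/measurable_EFinP; exact: measurable_t_kernel.
- exists [set 0]; split; [exact: measurable_set1|exact: lebesgue_measure_set1|].
  move=> x /=; apply: contra_notP => /eqP x0 _.
  rewrite -(student_density gaussXW q_gt0 x0) /g.
  under eq_integral do rewrite EFinM.
  rewrite ge0_integralZl//=.
  + apply/measurable_EFinP; apply: measurable_funM => //.
    apply: (measurableT_comp (@measurable_normal_pdf R 0 1)).
    exact: measurable_funM.
  + by move=> w _; rewrite lee_fin mulr_ge0 ?powR_ge0 ?normal_pdf_ge0.
  + by rewrite lee_fin.
Qed.

Lemma student_mass_t_kernel :
  (\int[mu]_x (t_kernel q x)%:E * student_mass q = 1)%E.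
Proof.
have := @student_law_ge0 (fun=> 1) 1 (fun=> cvg_cst _) (fun=> ler01) (fun=> lexx _).
rewrite integral_cst//= probability_setT mule1.
under eq_integral do rewrite mul1e muleC.
rewrite ge0_integralZl//; last 3 first.
- by apply/measurable_EFinP; exact: measurable_t_kernel.
- by move=> x _; rewrite lee_fin ltW// t_kernel_gt0.
- exact: student_mass_ge0.
by rewrite muleC => <-.
Qed.

(** Two nonnegative extended reals with product 1 are finite and inverse to each other. *)
Lemma student_massE :
  student_mass q = ((fine (\int[mu]_x (t_kernel q x)%:E)%E)^-1)%:E
  /\ (\int[mu]_x (t_kernel q x)%:E)%E \is a fin_num.
Proof.
have I0 : (0 <= \int[mu]_x (t_kernel q x)%:E)%E.
  by apply: integral_ge0 => x _; rewrite lee_fin ltW// t_kernel_gt0.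
have := student_mass_t_kernel; have := student_mass_ge0.
move: (student_mass q) I0; case: (integral _ _ _) => [i| |]//; case=> [m| |]//.
- rewrite -EFinM => _ _ [im1]; split => //=; congr EFin.
  have i0 : i != 0 by apply: contra_eq_neq im1 => ->; rewrite mul0r eq_sym oner_eq0.
  by apply: (mulfI i0); rewrite im1 divff.
- rewrite lee_fin le_eqVlt => /predU1P[<-|i0] _; first by rewrite mul0e => /eqP; rewrite eq_sym onee_eq0.
  by rewrite gt0_muley.
- rewrite lee_fin => _; rewrite le_eqVlt => /predU1P[<-|m0]; first by rewrite mule0 => /eqP; rewrite eq_sym onee_eq0.
  by rewrite gt0_mulye.
Qed.

Lemma integral_t_pdf : (\int[mu]_x (t_pdf q x)%:E = 1)%E.
Proof.
have [mE fI] := student_massE; rewrite /t_pdf.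
under eq_integral do rewrite EFinM -mE muleC.
rewrite ge0_integralZl ?student_mass_ge0//; last 2 first.
- by apply/measurable_EFinP; exact: measurable_t_kernel.
- by move=> x _; rewrite lee_fin ltW// t_kernel_gt0.
by rewrite muleC student_mass_t_kernel.
Qed.

(** A bounded [f] becomes nonnegative after adding its bound [M], which contributes [M] on both
    sides because both laws have mass 1. *)
Lemma student_law (f : R -> R) : bcont f ->
  (\int[Q]_w (f (X w * powR (S w / q%:R) (- 2^-1)))%:E =
   \int[mu]_x (f x * t_pdf q x)%:E)%E.
Proof.
move=> [cf [M fM]].
have mf : measurable_fun [set: R] f by exact: continuous_measurable_fun.
have [mE fI] := student_massE.
have t0 x : 0 <= @t_pdf R q x.
  rewrite /t_pdf mulr_ge0 ?(ltW (t_kernel_gt0 _))// invr_ge0 fine_ge0//.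
  by apply: integral_ge0 => y _; rewrite lee_fin ltW// t_kernel_gt0.
have mt : measurable_fun [set: R] (@t_pdf R q).
  by apply: measurable_funM => //; exact: measurable_t_kernel.
have it : mu.-integrable [set: R] (EFin \o @t_pdf R q).
  apply/integrableP; split; first exact/measurable_EFinP.
  under eq_integral do rewrite /= ger0_norm//.
  by rewrite integral_t_pdf ltry.
have ift : mu.-integrable [set: R] (fun x => (f x * t_pdf q x)%:E).
  under eq_fun do rewrite EFinM muleC.
  apply: integrableMl => //.
  exists M; split; first exact: num_real.
  by move=> y My x _ /=; rewrite (le_trans (fM x))// ltW.
have cf' : continuous (fun x => f x + M) by move=> x; apply: cvgD; [exact: cf|exact: cvg_cst].
have f'0 x : 0 <= f x + M by have := fM x; rewrite ler_norml => /andP[]; lra.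
have f'M x : f x + M <= M + M by have := fM x; rewrite ler_norml => /andP[]; lra.
have := student_law_ge0 cf' f'0 f'M.
have mY : measurable_fun [set: T] (fun w => X w * powR (S w / q%:R) (- 2^-1)).
  apply: measurable_funM => //; apply: (measurableT_comp (measurable_powR _)).
  exact: measurable_funM.
have bfY : bmfun (fun w => f (X w * powR (S w / q%:R) (- 2^-1))).
  by split; [exact: measurableT_comp|exists M => w; exact: fM].
have bc := @bmfun_cst _ T R M.
rewrite integral_Rintegral; last exact: bmfunD.
rewrite bmRintegralD// Rintegral_cst1.
rewrite (_ : (\int[mu]_x _)%E = (\int[mu]_x (f x * t_pdf q x)%:E + M%:E)%E); last first.
  transitivity (\int[mu]_x ((f x * t_pdf q x)%:E + (M * t_pdf q x)%:E))%E.
    by apply: eq_integral => x _; rewrite mE -!EFinM -EFinD /t_pdf; congr EFin; ring.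
  rewrite integralD//; last first.
    by under eq_fun do rewrite EFinM; exact: integrableZl.
  congr (_ + _)%E; under eq_integral do rewrite EFinM.
  by rewrite integralZl// integral_t_pdf mule1.
rewrite EFinD => /(congr1 (fun u => u - M%:E)%E); rewrite !addeK// => <-.
exact: (@integral_Rintegral _ T R Q).
Qed.

End student_law.

(** * Slutsky's lemma *)

Section uniform_continuity.
Context {R : realType} (m : nat).
Implicit Types (H : 'cV[R]_m -> R) (x e : 'cV[R]_m).

(** Perturbations are measured entrywise to match [op1_mx]. *)
Definition unif_cont_cV H := forall eps : R, 0 < eps -> exists2 delta : R, 0 < delta &
  forall x e, (forall i, `|e i ord0| <= delta) -> `|H (x + e) - H x| <= eps.

Lemma continuous_trmx_rV : continuous (fun v : 'rV[R]_m => v^T : 'cV[R]_m).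
Proof.
move=> v A /nbhs_ballP[eps /= eps0 vA]; apply/nbhs_ballP; exists eps => //= u [_ vu].
by apply: vA; split => // i j; rewrite !mxE; exact: vu.
Qed.

Lemma compact_box_cV (k : R) : compact [set x : 'cV[R]_m | forall i, `|x i ord0| <= k].
Proof.
have := @continuous_compact _ _ (fun v : 'rV[R]_m => v^T : 'cV[R]_m)
  [set v : 'rV[R]_m | forall i, (`[- k, k]%classic : set R) (v ord0 i)].
rewrite (_ : _ @` _ = [set x : 'cV[R]_m | forall i, `|x i ord0| <= k]); last first.
  apply/seteqP; split => [x [v /= vk <-] i|x /= xk].
    by have := vk i; rewrite mxE /= in_itv/= ler_norml.
  by exists x^T; [move=> i; rewrite /= mxE in_itv/= -ler_norml|rewrite trmxK].
apply.
  by apply: continuous_subspaceT; exact: continuous_trmx_rV.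
by apply: (@rV_compact R m (fun=> `[- k, k]%classic)) => _; exact: segment_compact.
Qed.

Lemma compact_support_unif_cont_cV H (k : R) : continuous H ->
  (forall x i, k < `|x i ord0| -> H x = 0) -> unif_cont_cV H.
Proof.
move=> cH Hk eps eps0.
(* The margin 1 ensures that for [x] outside this box and entries of [e] at most 1, [H] vanishes at
   both [x] and [x + e]. *)
pose K := [set x : 'cV[R]_m | forall i, `|x i ord0| <= k + 1].
pose P (delta : R) x := forall e, (forall i, `|e i ord0| <= delta) -> `|H (x + e) - H x| <= eps.
have := @compact_box_cV (k + 1); rewrite -/K => /compact_near_coveringP.
move=> /(_ _ (0 : R)^'+ P _).
have cover : forall x, K x -> \forall x' \near x & i \near (0 : R)^'+, P i x'.
  move=> x _.
  have e20 : 0 < eps / 2 by rewrite divr_gt0.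
  have /cvg_ballP/(_ _ e20) := cH x.
  rewrite /= -nbhs_ballE => -[rho /= rho0 Hrho].
  have r20 : 0 < rho / 2 by rewrite divr_gt0.
  exists (ball x (rho / 2), [set t : R | t < rho / 2]).
    split => /=; first exact: nbhsx_ballx.
    exact: nbhs_right_lt.
  move=> [y t] /= [xy trho] e et.
  have b1 : ball x rho y by apply: le_ball xy; lra.
  have b2 : ball x rho (y + e).
    split=> // i j; rewrite (ord1 j) mxE.
    have [_ /(_ i ord0)] := xy; rewrite /ball/= => xyi.
    rewrite opprD addrA (le_lt_trans (ler_normB _ _))//.
    by have := et i; lra.
  have := Hrho _ b1; have := Hrho _ b2; rewrite /ball/= => h2 h1.
  rewrite (_ : _ - _ = (H x - H y) - (H x - H (y + e))); last by ring.
  by rewrite (le_trans (ler_normB _ _))//; lra.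
move=> /(_ cover) nearP.
have : \forall d \near (0 : R)^'+, [/\ 0 < d, d <= 1 & K `<=` P d].
  near=> d; split; first by near: d; exact: nbhs_right_gt.
    by near: d; apply: nbhs_right_le.
  by near: d.
move=> /filter_ex [d [d0 d1 KP]].
exists d => // x e ed.
have [xK|xK] := pselect (K x); first exact: KP.
have /existsNP[i /negP] : ~ (forall i, `|x i ord0| <= k + 1) by [].
rewrite -ltNge => xi.
have xk : k < `|x i ord0| by lra.
have xek : k < `|(x + e) i ord0|.
  by rewrite mxE; have := lerB_normD (x i ord0) (e i ord0); have := ed i; lra.
by rewrite (Hk x i)// (Hk (x + e) i)// subr0 normr0 ltW.
Unshelve. all: by end_near. Qed.

End uniform_continuity.

(* ['cV[R]_m] carries no sigma-algebra here: measurability is tested along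
   entrywise measurable maps. *)
Definition measurable_cVfun (R : realType) (m : nat) (H : 'cV[R]_m -> R) : Prop :=
  forall d (T : measurableType d) (Y : T -> 'cV[R]_m), rv_mx Y ->
    measurable_fun [set: T] (fun w => H (Y w)).

Section slutsky.
Context {R : realType} d (T : measurableType d) (P : probability T R)
  d' (T' : measurableType d') (Q : probability T' R)
  (I : Type) (F : set_system I) {FF : Filter F} (m : nat).
Variables (z e : I -> T -> 'cV[R]_m) (Z : T' -> 'cV[R]_m).
Hypotheses (mz : forall i, rv_mx (z i)) (me : forall i, rv_mx (e i)) (mZ : rv_mx Z).
Hypothesis zZ : cvg_dist_vec P Q F z Z.
Hypothesis e0 : op1_mx P F e.

Let mY i : rv_mx (fun w => z i w + e i w).
Proof.
by move=> k l; under eq_fun do rewrite mxE; apply: measurable_funD; [exact: mz|exact: me].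
Qed.

(** If all entries of [e] are at most [delta], uniform continuity bounds the change of [H];
    otherwise the change is at most [2 M], on an event made improbable by a union bound over
    entries. *)
Lemma slutsky_unif_cont (H : 'cV[R]_m -> R) (M : R) : continuous H ->
  (forall x, `|H x| <= M) -> unif_cont_cV H -> measurable_cVfun H ->
  \int[P]_w H (z i w + e i w) @[i --> F] --> \int[Q]_w H (Z w).
Proof.
move=> cH HM uH mH.
have M0 : 0 <= M := le_trans (normr_ge0 _) (HM 0).
have bY i : bmfun (fun w => H (z i w + e i w)) by split; [exact: mH|exists M].
have bz i : bmfun (fun w => H (z i w)) by split; [exact: mH|exists M].
have bZ : bmfun (fun w => H (Z w)) by split; [exact: mH|exists M].
have cz : \int[P]_w H (z i w) @[i --> F] --> \int[Q]_w H (Z w).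
  have := zZ (conj cH (ex_intro _ M HM)).
  rewrite integral_Rintegral// => /fine_cvgP[_].
  by [].
apply/cvgrPdist_le => eps eps0.
have e30 : 0 < eps / 3 by rewrite divr_gt0.
have [delta delta0 Hd] := uH _ e30.
pose B i j := [set w | delta < `|e i w j ord0|].
have mB i j : measurable (B i j).
  rewrite [B i j](_ : _ = (fun w => `|e i w j ord0|) @^-1` `]delta, +oo[%classic); last first.
    by apply/seteqP; split => w /=; rewrite in_itv/= andbT.
  rewrite -[X in measurable X]setTI.
  have : measurable_fun [set: T] (fun w => `|e i w j ord0|).
    by apply: measurableT_comp => //; exact: me.
  by apply => //; exact: measurable_itv.
(* Chosen so that [(2 M + 1) (m + 1) eta = eps / 3]; the added ones keep the divisors positive when
   [M] or [m] is 0. *)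
pose eta := eps / 3 / (2 * M + 1) / m.+1%:R.
have M1 : 0 < 2 * M + 1 by lra.
have eta0 : 0 < eta by rewrite !divr_gt0.
have nB : \forall i \near F, forall j, fine (P (B i j)) <= eta.
  have : \forall i \near F, forall j : 'I_m, j \in enum 'I_m -> fine (P (B i j)) <= eta.
    elim: (enum 'I_m) => [|j s IHs]; first by apply: nearW.
    have /fine_cvgP[_ /cvgrPdist_le /(_ _ eta0)] := e0 j ord0 delta0.
    move=> ej; near=> i => k; rewrite inE => /predU1P[->|ks].
      have : `|0 - fine (P (B i j))| <= eta by near: i; exact: ej.
      by rewrite sub0r normrN ger0_norm// fine_ge0.
    by move: k ks; near: i; exact: IHs.
  by apply: filterS => i Hi j; apply: Hi; rewrite mem_enum.
near=> i.
have diff : `|\int[P]_w H (z i w + e i w) - \int[P]_w H (z i w)| <= eps / 3 + eps / 3.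
  rewrite -bmRintegralB//.
  have bind j : bmfun (\1_(B i j) : T -> R).
    by apply: bmfun_le1 => //; move=> w; rewrite indicE; case: (_ \in _); rewrite /= ?lexx ?ler01.
  have bsum (s : seq 'I_m) : bmfun (fun w => \sum_(j <- s) \1_(B i j) w : R) /\
      \int[P]_w (\sum_(j <- s) \1_(B i j) w) = \sum_(j <- s) fine (P (B i j)).
    elim: s => [|j s [bs Es]].
      split; first by under eq_fun do rewrite big_nil; exact: bmfun_cst.
      by rewrite big_nil; under eq_Rintegral do rewrite big_nil; rewrite Rintegral_cst1.
    split; first by under eq_fun do rewrite big_cons; exact: bmfunD.
    rewrite big_cons; under eq_Rintegral do rewrite big_cons.
    rewrite bmRintegralD// Es; congr (_ + _).
    by rewrite /Rintegral integral_indic// setIT.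
  have [bs Es] := bsum (index_enum 'I_m).
  have bg : bmfun (fun w => eps / 3 + 2 * M * \sum_j \1_(B i j) w).
    by apply: bmfunD; [exact: bmfun_cst|apply: bmfunM => //; exact: bmfun_cst].
  apply: (@le_trans _ _ (\int[P]_w (eps / 3 + 2 * M * \sum_j \1_(B i j) w))).
    apply: bmRintegral_norm => //; first exact: bmfunB.
    move=> w; have [/forallP small|/forallPn[j]] := boolP [forall j, `|e i w j ord0| <= delta].
      apply: (le_trans (Hd _ _ small)); rewrite lerDl mulr_ge0 ?mulr_ge0//.
      by apply: sumr_ge0 => j _; rewrite indicE ler0n.
    rewrite -ltNge => ej.
    apply: (@le_trans _ _ (2 * M)).
      by rewrite (le_trans (ler_normB _ _))//; have := HM (z i w + e i w); have := HM (z i w); lra.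
    apply: ler_wpDl; first exact: ltW.
    rewrite ler_peMr ?mulr_ge0// (bigD1 j)//= indicE mem_set//= lerDl.
    by apply: sumr_ge0 => l _; rewrite indicE ler0n.
  rewrite bmRintegralD//; [|exact: bmfun_cst|by apply: bmfunM => //; exact: bmfun_cst].
  rewrite Rintegral_cst1 bmRintegralZl// Es lerD2l.
  apply: (@le_trans _ _ ((2 * M + 1) * (m.+1%:R * eta))); last first.
    suff -> : (2 * M + 1) * (m.+1%:R * eta) = eps / 3 by [].
    by rewrite /eta; field; rewrite nat1r pnatr_eq0/= gt_eqF.
  apply: ler_pM => //; [by rewrite mulr_ge0|by apply: sumr_ge0 => j _; rewrite fine_ge0|lra|].
  apply: (@le_trans _ _ (\sum_(j < m) eta)).
    by apply: ler_sum => j _; move: j; near: i.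
  rewrite sumr_const card_ord -[leLHS]mulr_natl.
  by apply: ler_wpM2r; [exact: ltW|rewrite ler_nat].
have close : `|\int[Q]_w H (Z w) - \int[P]_w H (z i w)| <= eps / 3.
  by near: i; move/cvgrPdist_le : cz; exact.
rewrite (_ : _ - _ = (\int[Q]_w H (Z w) - \int[P]_w H (z i w)) -
  (\int[P]_w H (z i w + e i w) - \int[P]_w H (z i w))); last by ring.
by rewrite (le_trans (ler_normB _ _))//; lra.
Unshelve. all: by end_near. Qed.

(** Truncation by [chi k] costs at most [M (1 - E chi k)] on each side. For [Z] this is small by
    choice of [k]; for [z + e] it is then eventually small because [E chi k (z + e)] converges to
    [E chi k (Z)], which plays the part of tightness. *)
Lemma slutsky_mapping (phi : 'cV[R]_m -> R) (chi : nat -> 'cV[R]_m -> R) (M : R) :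
  measurable_cVfun phi -> (forall x, `|phi x| <= M) ->
  (forall k x, 0 <= chi k x <= 1) ->
  (forall k, measurable_cVfun (chi k)) ->
  (forall k, continuous (chi k)) -> (forall k, unif_cont_cV (chi k)) ->
  (forall k, continuous (fun x => phi x * chi k x)) ->
  (forall k, unif_cont_cV (fun x => phi x * chi k x)) ->
  \int[Q]_w chi k (Z w) @[k --> \oo] --> (1 : R) ->
  (\int[P]_w (phi (z i w + e i w))%:E @[i --> F] --> \int[Q]_w (phi (Z w))%:E)%E.
Proof.
move=> mphi phiM chi01 mchi cchi uchi cpchi upchi chi1.
have M0 : 0 <= M := le_trans (normr_ge0 _) (phiM 0).
have mpchi k : measurable_cVfun (fun x => phi x * chi k x).
  by move=> d0 T0 Y mY0; apply: measurable_funM; [exact: mphi|exact: mchi].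
have chin k x : `|chi k x| <= 1 by have /andP[c0 c1] := chi01 k x; rewrite ger0_norm.
have pchiM k x : `|phi x * chi k x| <= M by rewrite normrM -[leRHS]mulr1 ler_pM.
have bphiY i : bmfun (fun w => phi (z i w + e i w)) by split; [exact: mphi|exists M].
have bphiZ : bmfun (fun w => phi (Z w)) by split; [exact: mphi|exists M].
have bchiY k i : bmfun (fun w => chi k (z i w + e i w)) by split; [exact: mchi|exists 1].
have bchiZ k : bmfun (fun w => chi k (Z w)) by split; [exact: mchi|exists 1].
rewrite integral_Rintegral//; apply/fine_cvgP; split.
  by apply: nearW => i; rewrite integral_Rintegral.
rewrite (_ : _ \o _ = fun i => \int[P]_w phi (z i w + e i w)); last by [].
have trunc d0 (T0 : measurableType d0) (P0 : probability T0 R) (Y : T0 -> 'cV[R]_m) k : rv_mx Y ->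
    `|\int[P0]_w phi (Y w) - \int[P0]_w (phi (Y w) * chi k (Y w))| <=
    M * (1 - \int[P0]_w chi k (Y w)).
  move=> mY0.
  have b1 : bmfun (fun w => phi (Y w)) by split; [exact: mphi|exists M].
  have b2 : bmfun (fun w => chi k (Y w)) by split; [exact: mchi|exists 1].
  have b3 := @bmfun_cst _ T0 R 1.
  rewrite -bmRintegralB//; last exact: bmfunM.
  rewrite -(Rintegral_cst1 P0 1) -bmRintegralB// -bmRintegralZl; last exact: bmfunB.
  apply: bmRintegral_norm.
  - by apply: bmfunB => //; exact: bmfunM.
  - by apply: bmfunM; [exact: bmfun_cst|exact: bmfunB].
  move=> w; rewrite -[X in X - _]mulr1 -mulrBr normrM.
  have /andP[c0 c1] := chi01 k (Y w).
  by rewrite (ger0_norm (_ : 0 <= 1 - chi k (Y w))) ?subr_ge0// ler_wpM2r ?subr_ge0.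
apply/cvgrPdist_le => eps eps0.
(* The errors are [M eta] for the limit, [2 M eta] for the sample and [eta] between the truncated
   expectations. *)
pose eta := eps / (3 * M + 1).
have M1 : 0 < 3 * M + 1 by lra.
have eta0 : 0 < eta by rewrite divr_gt0.
have [k chik] : exists k, 1 - \int[Q]_w chi k (Z w) <= eta.
  have /cvgrPdist_le/(_ _ eta0)/filter_ex[k Hk] := chi1.
  by exists k; apply: le_trans Hk; exact: ler_norm.
have c1 := slutsky_unif_cont (cchi k) (chin k) (uchi k) (mchi k).
have c2 := slutsky_unif_cont (cpchi k) (pchiM k) (upchi k) (mpchi k).
near=> i.
have h1 : `|\int[Q]_w chi k (Z w) - \int[P]_w chi k (z i w + e i w)| <= eta.
  by near: i; move/cvgrPdist_le : c1; exact.
have h2 : `|\int[Q]_w (phi (Z w) * chi k (Z w)) -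
    \int[P]_w (phi (z i w + e i w) * chi k (z i w + e i w))| <= eta.
  by near: i; move/cvgrPdist_le : c2; exact.
have t1 := trunc _ _ Q Z k mZ.
have t2 := trunc _ _ P (fun w => z i w + e i w) k (mY i).
have e1 : M * (1 - \int[Q]_w chi k (Z w)) <= M * eta by exact: ler_wpM2l.
have e2 : M * (1 - \int[P]_w chi k (z i w + e i w)) <= M * (2 * eta).
  apply: ler_wpM2l => //; move: h1 chik; rewrite ler_norml => /andP[]; lra.
have e3 : 3 * (M * eta) + eta = eps by rewrite /eta; field; rewrite gt_eqF.
move: t1 t2 h2; set a := \int[Q]_w phi (Z w); set b := \int[P]_w _.
set a' := \int[Q]_w (_ * _); set b' := \int[P]_w _ => t1 t2 h2.
rewrite (_ : a - b = (a - a') + ((a' - b') - (b - b'))); last by ring.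
rewrite (le_trans (ler_normD _ _))//.
have := ler_normB (a' - b') (b - b'); lra.
Unshelve. all: by end_near. Qed.

End slutsky.

(** * The limit theorem *)

Section quadratic_form.
Context {R : realType} (m : nat) (C : 'M[R]_m).
Hypothesis symC : C^T = C.
Implicit Types u v : 'cV[R]_m.

Definition bilin u v := (u^T *m C *m v) ord0 ord0.

Lemma bilinDl u1 u2 v : bilin (u1 + u2) v = bilin u1 v + bilin u2 v.
Proof. by rewrite /bilin linearD/= !mulmxDl mxE. Qed.

Lemma bilinDr u v1 v2 : bilin u (v1 + v2) = bilin u v1 + bilin u v2.
Proof. by rewrite /bilin mulmxDr mxE. Qed.

Lemma bilinZl (a : R) u v : bilin (a *: u) v = a * bilin u v.
Proof. by rewrite /bilin linearZ/= -!scalemxAl mxE. Qed.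

Lemma bilinZr (a : R) u v : bilin u (a *: v) = a * bilin u v.
Proof. by rewrite /bilin -scalemxAr mxE. Qed.

Lemma bilinC u v : bilin u v = bilin v u.
Proof.
rewrite /bilin -[in LHS](trmxK (u^T *m C *m v)) mxE.
by rewrite !trmx_mul trmxK symC mulmxA.
Qed.

Lemma bilin_sqrD (t : R) u v :
  bilin (u + t *: v) (u + t *: v) = bilin u u + (2 * t * bilin v u + t ^+ 2 * bilin v v).
Proof. by rewrite !bilinDl !bilinDr !bilinZl !bilinZr (bilinC u v); ring. Qed.

(** At [t = - b / k] with [k = |c| + 1] the polynomial is [b^2 (c - 2 k) / k^2], and [c - 2 k < 0];
    this [k] avoids dividing by [c], which may be 0. *)
Lemma quadratic_ge0_linear_eq0 (b c : R) : (forall t, 0 <= 2 * t * b + t ^+ 2 * c) -> b = 0.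
Proof.
move=> H; pose k := `|c| + 1.
have k0 : 0 < k by rewrite ltr_wpDl.
have ck : c <= k - 1 by rewrite /k addrK ler_norm.
have := H (- b / k).
rewrite (_ : _ + _ = b ^+ 2 * (c - 2 * k) / k ^+ 2); last by field; rewrite gt_eqF.
rewrite pmulr_lge0; last by rewrite invr_gt0 exprn_gt0.
rewrite nmulr_lge0; last by lra.
by rewrite le_eqVlt ltNge sqr_ge0 orbF sqrf_eq0 => /eqP.
Qed.

(** First-order condition along the line [v + t u]. *)
Lemma bilin_minimizer_eq0 u v :
  (forall t, bilin v v <= bilin (v + t *: u) (v + t *: u)) -> bilin u v = 0.
Proof.
move=> min; apply: (@quadratic_ge0_linear_eq0 _ (bilin u u)) => t.
by have := min t; rewrite bilin_sqrD lerDl.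
Qed.

(** If [v^T C v = 0], then [v] is a global minimiser of the semidefinite form, and the first-order
    condition in each coordinate direction annihilates the entries of [C v]. *)
Lemma bilin_psd_gt0 v : (forall u, 0 <= bilin u u) -> C *m v != 0 -> 0 < bilin v v.
Proof.
move=> psd Cv; rewrite lt_neqAle psd andbT eq_sym; apply: contra_neq Cv => v0.
apply/colP => i; rewrite [RHS]mxE.
have <- : bilin (delta_mx i ord0) v = (C *m v) i ord0.
  by rewrite /bilin trmx_delta -mulmxA -rowE [LHS]mxE.
by apply: bilin_minimizer_eq0 => t; rewrite v0; exact: psd.
Qed.

End quadratic_form.

Section continuous_at_ops.
Context {R : realType} {T : topologicalType}.
Implicit Types (f g : T -> R) (x : T).

Lemma continuous_atM f g x : {for x, continuous f} -> {for x, continuous g} ->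
  {for x, continuous (fun y => f y * g y)}.
Proof. by move=> cf cg; exact: cvgM. Qed.

Lemma continuous_atB f g x : {for x, continuous f} -> {for x, continuous g} ->
  {for x, continuous (fun y => f y - g y)}.
Proof. by move=> cf cg; exact: cvgB. Qed.

Lemma continuous_at_cst (c : R) x : {for x, continuous (fun=> c : R)}.
Proof. exact: cvg_cst. Qed.

Lemma continuous_near0 f x : (\forall y \near x, f y = 0) -> {for x, continuous f}.
Proof.
move=> f0; have fx : f x = 0 := nbhs_singleton f0.
by rewrite /prop_for /continuous_at fx; exact: cvg_near_cst.
Qed.

Lemma near_dist_lt f x (e : R) : {for x, continuous f} -> 0 < e ->
  \forall y \near x, `|f x - f y| < e.
Proof. by move=> cf; move: e; exact/cvgrPdist_lt. Qed.

End continuous_at_ops.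

(** * The t-statistic as a function on vectors, and its cutoffs *)

Section tstat.
Context {R : realType} (m q : nat) (v : 'cV[R]_m) (U : 'M[R]_(m, q)).
Implicit Types x : 'cV[R]_m.

Definition tnum x := (v^T *m x) ord0 ord0.
Definition tsqsum x := \sum_(l < q) (U^T *m x) l ord0 ^+ 2.
(* Written with [powR], which is known to be measurable; [powR 0 (- 2^-1) = 0 = 0^-1]
   makes it agree with the quotient also where [tsqsum x = 0]. *)
Definition tstat x := tnum x * powR (tsqsum x / q%:R) (- 2^-1).

Lemma tsqsum_ge0 x : 0 <= tsqsum x.
Proof. by apply: sumr_ge0 => l _; exact: sqr_ge0. Qed.

Lemma tstatE x : tstat x = tnum x / Num.sqrt (q%:R^-1 * tsqsum x).
Proof.
have h : 0 <= tsqsum x / q%:R by rewrite divr_ge0// tsqsum_ge0.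
by rewrite /tstat powRN (powR12_sqrt h) [q%:R^-1 * _]mulrC.
Qed.

Lemma tstat_scale (k : R) x : 0 < k -> tstat (k *: x) = tstat x.
Proof.
move=> k0; rewrite !tstatE.
have -> : tnum (k *: x) = k * tnum x by rewrite /tnum -scalemxAr mxE.
have -> : tsqsum (k *: x) = k ^+ 2 * tsqsum x.
  rewrite /tsqsum mulr_sumr; apply: eq_bigr => l _.
  by rewrite -scalemxAr mxE exprMn.
rewrite mulrCA sqrtrM ?sqr_ge0// sqrtr_sqr ger0_norm ?ltW//.
by rewrite invfM mulrACA divff ?mul1r// gt_eqF.
Qed.

Lemma rv_mx_mulmx d (T : measurableType d) n (B : 'M[R]_(n, m)) (Y : T -> 'cV[R]_m) :
  rv_mx Y -> rv_mx (fun w => B *m Y w).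
Proof.
move=> mY i j; under eq_fun do rewrite mxE.
by apply: measurable_sum => l; apply: measurable_funM => //; exact: mY.
Qed.

Lemma measurable_tsqsum : measurable_cVfun tsqsum.
Proof.
move=> d T Y mY; apply: measurable_sum => l; apply: measurable_funX.
exact: (rv_mx_mulmx _ mY).
Qed.

Lemma measurable_tstat : measurable_cVfun tstat.
Proof.
move=> d T Y mY; apply: measurable_funM; first exact: (rv_mx_mulmx _ mY).
apply: (measurableT_comp (measurable_powR _)); apply: measurable_funM => //.
exact: measurable_tsqsum.
Qed.

Lemma continuous_sumr n (F : 'I_n -> 'cV[R]_m -> R) :
  (forall l, continuous (F l)) -> continuous (fun x => \sum_(l < n) F l x).
Proof.
by move=> cF; apply: continuous_big => [|l _]; [exact: add_continuous|exact: cF].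
Qed.

Lemma continuous_mulmx_entry n (B : 'M[R]_(n, m)) i :
  continuous (fun x : 'cV[R]_m => (B *m x) i ord0).
Proof.
rewrite (_ : (fun x => _) = (fun x : 'cV[R]_m => \sum_j B i j * x j ord0)); last first.
  by apply/funext => x; rewrite mxE.
apply: (@continuous_sumr _ (fun l x => B i l * x l ord0)) => l x.
apply: (@continuous_comp _ _ _ (fun x : 'cV[R]_m => x l ord0) (fun t : R => B i l * t)).
  exact: coord_continuous.
exact: mulrl_continuous.
Qed.

Lemma continuous_tsqsum : continuous tsqsum.
Proof.
apply: continuous_sumr => l x.
apply: (@continuous_comp _ _ _ (fun x : 'cV[R]_m => (U^T *m x) l ord0) (fun t : R => t ^+ 2)).
  exact: continuous_mulmx_entry.
exact: exprn_continuous.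
Qed.

Lemma continuous_tstat x : (0 < q)%N -> 0 < tsqsum x -> {for x, continuous tstat}.
Proof.
move=> q0 Sx; apply: continuous_atM; first exact: (@continuous_mulmx_entry _ v^T ord0).
apply: (@continuous_comp _ _ _ (fun x => tsqsum x / q%:R) (fun t : R => powR t (- 2^-1))).
  by apply: continuous_atM; [exact: continuous_tsqsum|exact: continuous_at_cst].
by apply: continuous_powR_pos; rewrite divr_gt0// ltr0n.
Qed.

(** [min (max t 0) 1] written with absolute values, so that continuity follows from that of the
    norm. *)
Definition clamp01 (t : R) := (`|t| - `|t - 1| + 1) / 2.

Lemma clamp01_bounds t : 0 <= clamp01 t <= 1.
Proof.
rewrite /clamp01; have := lerB_dist t 1; have := lerB_dist 1 t.
have := ler_normD (t - 1) 1; rewrite subrK normr1 [`|1 - t|]distrC => h1 h2 h3.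
have h4 : `|t - 1| <= `|t| + 1 by have := ler_normB t 1; rewrite normr1.
by apply/andP; split; lra.
Qed.

Lemma clamp01_le0 t : t <= 0 -> clamp01 t = 0.
Proof. by move=> t0; rewrite /clamp01 ler0_norm// ler0_norm; [field|lra]. Qed.

Lemma clamp01_ge1 t : 1 <= t -> clamp01 t = 1.
Proof. by move=> t1; rewrite /clamp01 ger0_norm ?ger0_norm; [field|lra|lra]. Qed.

Lemma continuous_clamp01 : continuous clamp01.
Proof.
move=> t; apply: cvgM; last exact: cvg_cst.
apply: cvgD; last exact: cvg_cst.
apply: cvgB; first exact: norm_continuous.
apply: (@continuous_comp _ _ _ (fun t : R => t - 1) Num.norm).
  by apply: cvgB; [exact: cvg_id|exact: cvg_cst].
exact: norm_continuous.
Qed.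

Definition sqnorm x := \sum_(i < m) x i ord0 ^+ 2.

Lemma continuous_sqnorm : continuous sqnorm.
Proof.
apply: continuous_sumr => l x.
apply: (@continuous_comp _ _ _ (fun x : 'cV[R]_m => x l ord0) (fun t : R => t ^+ 2)).
  exact: coord_continuous.
exact: exprn_continuous.
Qed.

(** The first factor vanishes once the squared norm reaches [k + 1], which gives compact support;
    the second vanishes where [tsqsum x <= 1 / (k + 1)], a neighbourhood of the singular set of
    [tstat]. *)
Definition tcut (k : nat) x :=
  clamp01 (k.+1%:R - sqnorm x) * clamp01 (k.+1%:R * tsqsum x - 1).

Lemma tcut_bounds k x : 0 <= tcut k x <= 1.
Proof.
have /andP[a0 a1] := clamp01_bounds (k.+1%:R - sqnorm x).
have /andP[b0 b1] := clamp01_bounds (k.+1%:R * tsqsum x - 1).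
by rewrite /tcut mulr_ge0//= mulr_ile1.
Qed.

Lemma measurable_tcut k : measurable_cVfun (tcut k).
Proof.
move=> d T Y mY.
have mc : measurable_fun [set: R] clamp01.
  by apply: continuous_measurable_fun; exact: continuous_clamp01.
apply: measurable_funM; apply: (measurableT_comp mc).
  apply: measurable_funB => //; apply: measurable_sum => l.
  by apply: measurable_funX; exact: mY.
apply: measurable_funB => //; apply: measurable_funM => //.
exact: measurable_tsqsum.
Qed.

Lemma continuous_tcut k : continuous (tcut k).
Proof.
move=> x; apply: (@continuous_atM _ _ (fun x => clamp01 (k.+1%:R - sqnorm x)) (fun x => clamp01 (k.+1%:R * tsqsum x - 1))).
  apply: (@continuous_comp _ _ _ (fun x => k.+1%:R - sqnorm x) clamp01).
    by apply: continuous_atB; [exact: continuous_at_cst|exact: continuous_sqnorm].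
  exact: continuous_clamp01.
apply: (@continuous_comp _ _ _ (fun x => k.+1%:R * tsqsum x - 1) clamp01).
  apply: continuous_atB; last exact: continuous_at_cst.
  by apply: continuous_atM; [exact: continuous_at_cst|exact: continuous_tsqsum].
exact: continuous_clamp01.
Qed.

Lemma tcut_support k x i : k.+1%:R < `|x i ord0| -> tcut k x = 0.
Proof.
move=> kx; rewrite /tcut clamp01_le0 ?mul0r// subr_le0.
(* Entries exceeding [k + 1] exceed 1, so their squares are at least as large and the bound on the
   squared norm applies. *)
have k1 : 1 <= k.+1%:R :> R by rewrite ler1n.
apply: (@le_trans _ _ (x i ord0 ^+ 2)).
  rewrite -[x i ord0 ^+ 2](real_normK (num_real _)) expr2.
  by apply: le_trans (ltW kx) _; rewrite ler_peMr//; lra.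
by rewrite /sqnorm (bigD1 i)//= lerDl; apply: sumr_ge0 => l _; exact: sqr_ge0.
Qed.

(** Near a point with [tsqsum x = 0] the cutoff is identically 0; elsewhere [tstat] itself is
    continuous. *)
Lemma continuous_tstat_cut (f : R -> R) k : (0 < q)%N -> continuous f ->
  continuous (fun x => f (tstat x) * tcut k x).
Proof.
move=> q0 cf x; have [S0|Sx] := eqVneq (tsqsum x) 0; last first.
  apply: continuous_atM; last exact: continuous_tcut.
  apply: (@continuous_comp _ _ _ tstat f); last exact: cf.
  by apply: continuous_tstat => //; rewrite lt_neqAle eq_sym Sx tsqsum_ge0.
apply: continuous_near0.
have k0 : 0 < k.+1%:R^-1 :> R by rewrite invr_gt0.
apply: filterS (near_dist_lt (@continuous_tsqsum x) k0) => y.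
rewrite S0 sub0r normrN ger0_norm ?tsqsum_ge0// => /ltW Sy.
rewrite /tcut (@clamp01_le0 (_ * _ - 1)) ?mulr0// subr_le0.
by rewrite mulrC -ler_pdivlMr// mul1r.
Qed.

Lemma cvg_tcut x : 0 < tsqsum x -> tcut k x @[k --> \oo] --> (1 : R).
Proof.
move=> Sx; apply: cvg_near_cst; near=> k.
have h1 : sqnorm x <= k%:R by near: k; exact: nbhs_infty_ger.
have h2 : 2 / tsqsum x <= k%:R by near: k; exact: nbhs_infty_ger.
rewrite /tcut !clamp01_ge1 ?mulr1//.
  by move: h2; rewrite ler_pdivrMr// -natr1; lra.
by rewrite -natr1; lra.
Unshelve. all: by end_near. Qed.

End tstat.

#[global] Instance panel_filter_filter (R : realType) (g2 : R) : Filter (panel_filter g2).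
Proof.
apply: filter_from_filter; first by exists 0%N.
move=> i j _ _; exists (maxn i j) => // -[N T] /= [hN [hT h]].
have inv_le k : (k <= maxn i j)%N -> ((maxn i j).+1%:R)^-1 <= k.+1%:R^-1 :> R.
  by move=> km; rewrite lef_pV2 ?posrE// ler_nat ltnS.
split; split; try split.
- exact: leq_trans (leq_maxl _ _) hN.
- exact: leq_trans (leq_maxl _ _) hT.
- exact: lt_le_trans h (inv_le _ (leq_maxl _ _)).
- exact: leq_trans (leq_maxr _ _) hN.
- exact: leq_trans (leq_maxr _ _) hT.
- exact: lt_le_trans h (inv_le _ (leq_maxr _ _)).
Qed.

Section gaussian_statistic.
Context {R : realType} d (T : measurableType d) (Q : probability T R) (m q : nat).
Variables (sigma2 : R) (C : 'M[R]_m) (v : 'cV[R]_m) (U : 'M[R]_(m, q)) (Z : T -> 'cV[R]_m).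
Hypotheses (sigma2_gt0 : 0 < sigma2) (symC : C^T = C) (q_gt0 : (0 < q)%N).
Hypothesis gaussZ : gaussian0_vec Q Z (sigma2 *: C).
Hypothesis vCv : 0 < bilin C v v.
Hypothesis UCU : U^T *m C *m U = bilin C v v *: 1%:M.
Hypothesis UCv : U^T *m C *m v = 0.

Let s := Num.sqrt (sigma2 * bilin C v v).

Let s_gt0 : 0 < s. Proof. by rewrite sqrtr_gt0 mulr_gt0. Qed.

Let X w := s^-1 * tnum v (Z w).
Let W l w := s^-1 * (U^T *m Z w) l ord0.

Lemma gaussian_statistic_lin (a0 : R) (c : 'I_q -> R) :
  normal0_rv Q (fun w => a0 * X w + \sum_(l < q) c l * W l w)
    (a0 ^+ 2 + \sum_(l < q) c l ^+ 2).
Proof.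
pose cc : 'cV[R]_q := \col_l c l.
(* The combination of [X] and [W] equals [a^T Z]. In its variance the cross terms vanish by [UCv],
   and [UCU] gives both blocks the common factor that [s] normalises. *)
pose a := s^-1 *: (a0 *: v + U *m cc).
have [_ /(_ a)] := gaussZ.
rewrite (_ : (fun w => (a^T *m Z w) ord0 ord0) =
    (fun w => a0 * X w + \sum_(l < q) c l * W l w)); last first.
  apply/funext => w; rewrite /a linearZ/= -scalemxAl mxE linearD/= mulmxDl mxE mulrDr.
  congr (_ + _).
    by rewrite linearZ/= -scalemxAl mxE mulrCA.
  rewrite trmx_mul -mulmxA mxE mulr_sumr; apply: eq_bigr => l _.
  have -> : cc^T ord0 l = c l by rewrite !mxE.
  by rewrite mulrCA.
rewrite (_ : (a^T *m (sigma2 *: C) *m a) ord0 ord0 = a0 ^+ 2 + \sum_(l < q) c l ^+ 2)//.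
have scaleC b : (b^T *m (sigma2 *: C) *m b) ord0 ord0 = sigma2 * bilin C b b.
  by rewrite -scalemxAr -scalemxAl mxE.
rewrite scaleC /a bilinZl bilinZr.
have UcU : bilin C (U *m cc) (U *m cc) = bilin C v v * \sum_(l < q) c l ^+ 2.
  rewrite {1}/bilin trmx_mul -!mulmxA (mulmxA C) (mulmxA U^T) (mulmxA U^T) UCU.
  rewrite -scalemxAl -scalemxAr mul1mx mxE; congr (_ * _).
  by rewrite mxE; apply: eq_bigr => l _; rewrite !mxE expr2.
have Ucv : bilin C (U *m cc) v = 0.
  by rewrite /bilin trmx_mul -!mulmxA (mulmxA U^T) UCv mulmx0 mxE.
rewrite bilinDl !bilinDr !bilinZl !bilinZr UcU Ucv (bilinC symC v) Ucv !mulr0 addr0 add0r.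
have s2 : s ^+ 2 = sigma2 * bilin C v v by rewrite sqr_sqrtr// ltW// mulr_gt0.
transitivity (sigma2 * bilin C v v / s ^+ 2 * (a0 ^+ 2 + \sum_(l < q) c l ^+ 2)).
  by field; rewrite gt_eqF.
by rewrite -s2 divff ?mul1r// expf_neq0// gt_eqF.
Qed.

Let tsqsumZ w : tsqsum U (Z w) = s ^+ 2 * gauss_sqsum W q w.
Proof.
rewrite /gauss_sqsum (eq_bigl xpredT) ?mulr_sumr; last by move=> l; rewrite ltn_ord.
apply: eq_bigr => l _; rewrite /W exprMn mulrA exprVn divff ?mul1r//.
by rewrite expf_neq0// gt_eqF.
Qed.

Lemma gaussian_tsqsum_gt0 : {ae Q, forall w, 0 < tsqsum U (Z w)}.
Proof.
apply: filterS (gauss_sqsum_gt0_ae gaussian_statistic_lin q_gt0) => w Sw.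
by rewrite tsqsumZ mulr_gt0// exprn_gt0.
Qed.

Lemma gaussian_tstat_law (f : R -> R) : bcont f ->
  (\int[Q]_w (f (tstat v U (Z w)))%:E = \int[lebesgue_measure]_x (f x * t_pdf q x)%:E)%E.
Proof.
move=> bf; rewrite -(student_law gaussian_statistic_lin q_gt0 bf).
apply: eq_integral => w _; congr (f _)%:E.
have si0 : 0 < s^-1 by rewrite invr_gt0.
rewrite -(tstat_scale v U (Z w) si0) /tstat; congr (_ * powR (_ / _) _).
  by rewrite /tnum -scalemxAr mxE.
rewrite /gauss_sqsum /tsqsum [RHS](eq_bigl xpredT); last by move=> l; rewrite ltn_ord.
by apply: eq_bigr => l _; rewrite -scalemxAr mxE.
Qed.

End gaussian_statistic.

Theorem theorem4 (R : realType) (d : measure_display) (Om : measurableType d)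
  (P : probability Om R) (g2 : R) (m Rb q : nat) (phi sigma2 : R)
  (r : nat * nat -> R) (mu : nat * nat -> 'cV[R]_Rb)
  (phihat0 : nat * nat -> Om -> R) (z0 : nat * nat -> Om -> R)
  (phihat : nat * nat -> Om -> 'cV[R]_m) (z : nat * nat -> Om -> 'cV[R]_m)
  (A : 'M[R]_(m, Rb)) (C : 'M[R]_m) (vstar : 'cV[R]_m) (U : 'M[R]_(m, q)) :
  let F := panel_filter g2 in
  let iota := (const_mx 1 : 'cV[R]_m) in
  let inV := fun v : 'cV[R]_m => v^T *m A = 0 /\ v^T *m iota = 1 in
  let quad := fun v : 'cV[R]_m => (v^T *m C *m v) ord0 ord0 in
  0 < g2 ->
  (forall NT, 0 < r NT) ->
  (* Assumption AD *)
  0 < sigma2 ->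
  (forall NT, measurable_fun [set: Om] (phihat0 NT)) ->
  (forall NT, measurable_fun [set: Om] (z0 NT)) ->
  cvg_dist_pdf P F z0 (normal_pdf 0 (Num.sqrt sigma2)) ->
  cvg_prob0 P F (fun NT w =>
    r NT * (phihat0 NT w - phi) - (z0 NT w + \sum_(k < Rb) mu NT k ord0)) ->
  (* Assumption JK *)
  (Rb + 2 <= m)%N ->
  (forall NT w (i : 'I_m), val i = 0%N -> phihat NT w i ord0 = phihat0 NT w) ->
  (forall NT, rv_mx (phihat NT)) ->
  (forall NT, rv_mx (z NT)) ->
  (exists (d' : measure_display) (T' : measurableType d')
          (Q : probability T' R) (Z : T' -> 'cV[R]_m),
     gaussian0_vec Q Z (sigma2 *: C) /\ cvg_dist_vec P Q F z Z) ->
  op1_mx P F (fun NT w =>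
    r NT *: (phihat NT w - phi *: iota) - (z NT w + A *m mu NT)) ->
  \rank A = Rb ->
  ~~ (iota^T <= A^T)%MS ->
  (exists v : 'cV[R]_m, (row_mx A iota)^T *m v = 0 /\ C *m v != 0) ->
  C^T = C ->
  (forall v : 'cV[R]_m, 0 <= quad v) ->
  (* V does not meet null(C) *)
  (forall v, inV v -> C *m v != 0) ->
  (* v* minimises v^T C v over V *)
  inV vstar -> (forall v, inV v -> quad vstar <= quad v) ->
  (1 <= q)%N ->
  U^T *m A = 0 -> U^T *m iota = 0 -> U^T *m C *m U = quad vstar *: 1%:M ->
  let phitilde := fun NT w => (vstar^T *m phihat NT w) ord0 ord0 in
  let sigtilde2 := fun NT w =>
    q%:R^-1 * \sum_(l < q) ((U^T *m phihat NT w) l ord0) ^+ 2 in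
  let sigtilde := fun NT w => Num.sqrt (sigtilde2 NT w) in
  cvg_dist_pdf P F (fun NT w => (phitilde NT w - phi) / sigtilde NT w)
    (@t_pdf R q).
Proof.
move=> F iota inV quad _ r_gt0 sigma2_gt0 _ _ _ _ _ _ mphihat mz [d' [T' [Q [Z [gaussZ zZ]]]]].
move=> e0 _ _ _ symC psd VnC Vv vmin q_gt0 UA Ui UCU phitilde sigtilde2 sigtilde f bf.
have [vA vi] := Vv.
have vCv : 0 < bilin C vstar vstar.
  by apply: bilin_psd_gt0 => //; exact: VnC.
(* Moving [vstar] along a column of [U] stays in the constraint set, since [UA] and [Ui] annihilate
   both constraints; minimality then gives the first-order condition. *)
have UCv : U^T *m C *m vstar = 0.
  apply/colP => l; rewrite [RHS]mxE.
  have <- : bilin C (col l U) vstar = (U^T *m C *m vstar) l ord0.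
    by rewrite /bilin tr_col -[row l U^T *m C]row_mul -row_mul mxE.
  apply: bilin_minimizer_eq0 => // t; apply: vmin; split.
    by rewrite linearD linearZ/= mulmxDl vA -scalemxAl tr_col -row_mul UA row0 scaler0 addr0.
  by rewrite linearD linearZ/= mulmxDl vi -scalemxAl tr_col -row_mul Ui row0 scaler0 addr0.
pose e NT w := r NT *: (phihat NT w - phi *: iota) - (z NT w + A *m mu NT).
have me NT : rv_mx (e NT).
  move=> i j; rewrite (_ : (fun w => e NT w i j) = fun w =>
    r NT * (phihat NT w i j - phi) - (z NT w i j + (A *m mu NT) i j)).
    apply: measurable_funB.
      apply: measurable_funM => //; apply: measurable_funB => //; exact: mphihat.
    by apply: measurable_funD => //; exact: mz.
  by apply/funext => w; rewrite /e !mxE mulr1.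
(* [z + e] equals [r (phihat - phi iota) - A mu]. Homogeneity removes [r], [vA] and [UA] remove the
   bias, [vi] centres the numerator at [phi], and [Ui] makes the denominator insensitive to the
   centring. *)
have Jz NT w : (phitilde NT w - phi) / sigtilde NT w = tstat vstar U (z NT w + e NT w).
  pose x := phihat NT w - phi *: iota.
  have -> : z NT w + e NT w = r NT *: (x - (r NT)^-1 *: (A *m mu NT)).
    rewrite scalerBr scalerA divff ?gt_eqF// scale1r /e -/x.
    move: (r NT *: x) (z NT w) (A *m mu NT) => a b c.
    by apply/matrixP => i j; rewrite !mxE; ring.
  rewrite tstat_scale// tstatE; congr (_ / Num.sqrt (_ * _)).
    rewrite /tnum mulmxBr -scalemxAr mulmxA vA mul0mx scaler0 subr0.
    rewrite mulmxBr -scalemxAr vi [RHS]mxE; congr (_ + _).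
    by rewrite !mxE eqxx mulr1.
  apply: eq_bigr => l _; congr (_ ^+ 2).
  rewrite mulmxBr -scalemxAr mulmxA UA mul0mx scaler0 subr0.
  by rewrite mulmxBr -scalemxAr Ui scaler0 subr0.
rewrite -(gaussian_tstat_law sigma2_gt0 symC q_gt0 gaussZ vCv UCU UCv bf).
under eq_fun do under eq_integral do rewrite Jz.
have [cf [M fM]] := bf; have [mZ _] := gaussZ.
have mf : measurable_fun [set: R] f by exact: continuous_measurable_fun.
apply: (@slutsky_mapping R _ Om P _ T' Q _ F _ m z e Z mz me mZ zZ e0
  (fun x => f (tstat vstar U x)) (fun k => tcut U k) M).
- by move=> d0 T0 Y mY; apply: (measurableT_comp mf); exact: measurable_tstat.
- by move=> x; exact: fM.
- by move=> k x; exact: tcut_bounds.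
- by move=> k; exact: measurable_tcut.
- by move=> k; exact: continuous_tcut.
- move=> k; apply: (@compact_support_unif_cont_cV _ _ _ k.+1%:R).
    exact: continuous_tcut.
  by move=> x i; exact: tcut_support.
- by move=> k; exact: continuous_tstat_cut.
- move=> k; apply: (@compact_support_unif_cont_cV _ _ _ k.+1%:R).
    exact: continuous_tstat_cut.
  by move=> x i xk; rewrite (tcut_support _ xk) mulr0.
(* The cutoffs tend to 1 wherever [tsqsum U (Z w) > 0], hence almost surely. *)
- rewrite -[X in _ --> X](Rintegral_cst1 Q).
  apply: (@bounded_convergence _ _ _ _ _ _ 1).
  + by move=> k; exact: measurable_tcut.
  + exact: measurable_cst.
  + have := gaussian_tsqsum_gt0 sigma2_gt0 symC q_gt0 gaussZ vCv UCU UCv.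
    by apply: filterS => w; exact: cvg_tcut.
  + by move=> k w; have /andP[c0 c1] := tcut_bounds U k (Z w); rewrite ger0_norm.
Qed.
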